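(* Let $n\ge 1$, $r>1$ and $a>1$. There are constants $c=c(a,r)$ and $d=d(n)$ such that the following holds. Let $f\in\mathcal{F}_r$, let $x\in\mathbb{R}^n$ and $t>0$ be such that $$B(x,t)\subset B_c(x,at)\subset B_c(0,1),$$ and let $\omega\subset B(x,t)$ be a measurable subset with $|\omega|>0$. Then $$\sup_{B(x,t)} f\le c\log\left(\frac{d\,|B(x,t)|}{|\omega|}\right)+\sup_{\omega} f .$$
   Context: $\mathbb{R}^n$ is identified with the real points of $\mathbb{C}^n$. $B(x,\rho)$ denotes the Euclidean ball in $\mathbb{R}^n$ with center $x$ and radius $\rho$, and $B_c(x,\rho)$ denotes the Euclidean ball in $\mathbb{C}^n$ with center $x$ and radius $\rho$. $|\cdot|$ denotes Lebesgue measure on $\mathbb{R}^n$. A function is plurisubharmonic on a domain $\Omega\subset\mathbb{C}^n$ if it is upper semicontinuous and its restriction to each component of the intersection of $\Omega$ with a complex line is subharmonic. For $r>1$, the class $\mathcal{F}_r$ consists of the plurisubharmonic functions $f:\mathbb{C}^n\to\mathbb{R}$ such that $\sup_{B_c(0,r)} f=0$ and $\sup_{B_c(0,1)} f\ge -1$. *)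

(* Defs.v *)
From HB Require Import structures.
From mathcomp Require Import all_boot all_order all_algebra.
From mathcomp Require Import all_classical all_reals all_analysis.
Set Implicit Arguments. Unset Strict Implicit. Unset Printing Implicit Defensive.
Import Order.TTheory GRing.Theory Num.Theory.
Local Open Scope classical_set_scope.
Local Open Scope ring_scope.

Definition Rn (R : realType) (n : nat) := 'I_n -> R.

(* Complex n-space C^n, a point z is the pair (Re z, Im z) of real vectors. *)
Definition Cn (R : realType) (n : nat) := ((Rn R n) * (Rn R n))%type.

Definition realpt (R : realType) n (x : Rn R n) : Cn R n := (x, fun _ => 0).

Definition dist2R (R : realType) n (x y : Rn R n) : R :=
  \sum_(i < n) (x i - y i) ^+ 2.
Definition dist2C (R : realType) n (z w : Cn R n) : R :=
  \sum_(i < n) ((z.1 i - w.1 i) ^+ 2 + (z.2 i - w.2 i) ^+ 2).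

Definition ballR (R : realType) n (x : Rn R n) (rho : R) : set (Rn R n) :=
  [set y | dist2R x y < rho ^+ 2].
Definition ballC (R : realType) n (z : Cn R n) (rho : R) : set (Cn R n) :=
  [set w | dist2C z w < rho ^+ 2].

Definition uscC (R : realType) n (f : Cn R n -> R) : Prop :=
  forall z (e : R), 0 < e -> exists2 del : R, 0 < del &
    forall w, dist2C z w < del ^+ 2 -> f w < f z + e.

(* the complex plane C = R^2 as pairs (Re, Im) *)
Definition uscC1 (R : realType) (g : R * R -> R) : Prop :=
  forall z (e : R), 0 < e -> exists2 del : R, 0 < del &
    forall w, (z.1 - w.1) ^+ 2 + (z.2 - w.2) ^+ 2 < del ^+ 2 -> g w < g z + e.

(* subharmonic on the whole plane C: upper semicontinuous and satisfying the
   sub-mean value inequality on every circle (every closed disc lies in C). *)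
Definition subharmonicC (R : realType) (g : R * R -> R) : Prop :=
  uscC1 g /\
  forall (z0 : R * R) (rho : R), 0 < rho ->
    ((g z0)%:E <=
     ((2 * pi)^-1)%:E *
     \int[lebesgue_measure]_(th in `[0%R, (2 * pi)%R]%classic)
        (g (z0.1 + rho * cos th, z0.2 + rho * sin th)%R)%:E)%E.

(* the complex line zeta |-> z + zeta w, zeta = (u,v) = u + i v *)
Definition cline (R : realType) n (z w : Cn R n) (zeta : R * R) : Cn R n :=
  (fun i => z.1 i + zeta.1 * w.1 i - zeta.2 * w.2 i,
   fun i => z.2 i + zeta.1 * w.2 i + zeta.2 * w.1 i).

(* plurisubharmonic on C^n: usc, and the restriction to every complex line
   (which is connected and contained in the domain C^n) is subharmonic *)
Definition psh (R : realType) n (f : Cn R n -> R) : Prop :=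
  uscC f /\ forall z w : Cn R n, subharmonicC (fun zeta => f (cline z w zeta)).

Definition classF (R : realType) n (r : R) (f : Cn R n -> R) : Prop :=
  psh f /\
  ereal_sup [set (f z)%:E | z in ballC (realpt (fun _ => 0%R)) r] = 0%E /\
  (- 1%:E <= ereal_sup [set (f z)%:E | z in ballC (realpt (fun _ => 0%R)) 1])%E.

Definition box (R : realType) n (a b : Rn R n) : set (Rn R n) :=
  [set y | forall i, a i <= y i <= b i].
Definition vol (R : realType) n (a b : Rn R n) : R := \prod_(i < n) (b i - a i).

Definition leb_outer (R : realType) n (A : set (Rn R n)) : \bar R :=
  ereal_inf [set s | exists a b : nat -> Rn R n,
    [/\ forall k i, a k i <= b k i,
        A `<=` \bigcup_k box (a k) (b k) &
        s = (\sum_(0 <= k <oo) (vol (a k) (b k))%:E)%E]].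

Definition leb_measurable (R : realType) n (A : set (Rn R n)) : Prop :=
  forall E : set (Rn R n),
    leb_outer E = (leb_outer (E `&` A) + leb_outer (E `&` ~` A))%E.

Arguments realpt {R n}.
Arguments dist2R {R n}.
Arguments dist2C {R n}.
Arguments ballR {R n}.
Arguments ballC {R n}.
Arguments uscC {R n}.
Arguments cline {R n}.
Arguments psh {R n}.
Arguments classF {R n}.
Arguments box {R n}.
Arguments vol {R n}.
Arguments leb_outer {R n}.
Arguments leb_measurable {R n}.

(* Main.v *)
(* Restricted to a complex line, [f] is subharmonic, and all estimates come from one
   comparison principle: if [u] is subharmonic, a majorant [kap + lam * sum_j log
   max(|z - s_j|, r)] of [u] on the boundary of a disc and on the small discs around
   the poles [s_j] is a majorant on the whole disc.  One pole gives the three circles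
   theorem and, by chaining, a Harnack inequality; many equidistant poles give a
   discrete Remez inequality: if [u <= M] on a disc, [u >= M - C] at some central
   point and [u <= M - K] near [N] real points with spacing [eta], then
   [K <= C' * log (d / (N * eta))].

   Three circles and Harnack bound [sup f] over B_c(x,at) by [sup f] over B_c(x,t/4)
   plus a constant depending on [a, r] only; the Remez inequality on the
   complexification of a real line through an almost maximal complex point moves that
   point to a real point [y0].  The sublevel set of [f] containing [om] is open, so it
   contains finitely many disjoint dyadic cells, with complex neighbourhoods,
   whose total volume is comparable to |om|; averaging over segments issuing from [y0]
   produces a line meeting these cells in many equidistant points, and the
   Remez inequality on this line concludes.  The dimension enters through the
   argument of the logarithm only. *)
Require Import Defs.
From HB Require Import structures.
From mathcomp Require Import all_boot all_order all_algebra.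
From mathcomp Require Import all_classical all_reals all_analysis.
From mathcomp Require Import ring lra zify.
Set Implicit Arguments. Unset Strict Implicit. Unset Printing Implicit Defensive.
Import Order.TTheory GRing.Theory Num.Theory.
Import numFieldNormedType.Exports.
Local Open Scope classical_set_scope.
Local Open Scope ring_scope.

(** * Integrals over circles and maxima of semicontinuous functions *)

(** The constant [c] may not depend on [n], so every analytic estimate is made on a single complex
    line, with a number of Harnack steps controlled by [a] and [r]. A measurable set is awkward on a
    line: its sections can be null, and a Remez inequality for them is a statement about capacity.
    Half of the gap [M - m] is therefore given up: [f] is strictly below [M - K] on [om], and upper
    semicontinuity spreads this bound to complex neighbourhoods of dyadic cells. A line through the
    cells then carries discs around [N] nodes of spacing [eta], and the bound sees only the product
    [N * eta], a discrete length of the section. This product stays under control however fine the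
    grid is, so counting on a finite grid takes the place of Fubini and polar coordinates. The
    logarithm of the theorem is the gap between the least possible potential of [N] such nodes,
    about [N * ln (N * eta)], and its value far away. *)

(* The integral is defined for arbitrary functions, so no measurability is required. *)
Lemma le_integral_all d (T : measurableType d) (R : realType)
    (mu : {measure set T -> \bar R}) (D : set T) (f g : T -> \bar R) :
  (forall x, D x -> (f x <= g x)%E) ->
  (\int[mu]_(x in D) f x <= \int[mu]_(x in D) g x)%E.
Proof.
move=> fg.
have fgD x : ((f \_ D) x <= (g \_ D) x)%E.
  by rewrite /patch; case: ifP => // /[!inE] /fg.
rewrite /integral; apply: leeB; apply: le_ereal_sup => _ [h hf <-];
  exists h => // x; apply: (le_trans (hf x)); rewrite ?funeposE ?funenegE.
- by rewrite ge_max le_max fgD /= le_max lexx orbT.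
- by rewrite ge_max le_max leeN2 fgD /= le_max lexx orbT.
Qed.

(** The difference of the two sides has derivative [y ^+ 3 / (1 + y)], of the sign of [y], hence its
    minimum 0 at 0. The cubic order matters: on circles of radius [rho] an error of order [rho ^+ 2]
    would swallow the gain from [eps |z|^2]. *)
Lemma ln1p_le_cubic (R : realType) (x : R) : -1 < x ->
  ln (1 + x) <= x - x ^+ 2 / 2 + x ^+ 3 / 3.
Proof.
move=> x1.
pose g (y : R) := y - y ^+ 2 / 2 + y ^+ 3 / 3 - ln (1 + y).
have dg (y : R) : -1 < y -> is_derive y 1 g (y ^+ 3 / (1 + y)).
  move=> y1; have y0 : 0 < 1 + y by lra.
  have dl := is_derive1_ln y0.
  rewrite /g; apply: is_derive_eq.
  rewrite /GRing.scale /=; field; lra.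
have g0 : g 0 = 0 by rewrite /g addr0 ln1 !expr0n /= !mul0r; ring.
suff : 0 <= g x by rewrite /g; lra.
case: (ltgtP x 0) => hx; last by rewrite hx g0.
- have [] := @MVT _ g (fun y => y ^+ 3 / (1 + y)) _ _ hx.
  + by move=> y; rewrite in_itv /= => /andP[h1 h2]; apply: dg; lra.
  + apply: derivable_within_continuous => y; rewrite in_itv /= => /andP[h1 h2].
    have y1 : -1 < y by lra.
    by have [] := dg _ y1.
  move=> y; rewrite in_itv /= => /andP[h1 h2]; rewrite g0 => e.
  suff : y ^+ 3 / (1 + y) * (0 - x) <= 0 by lra.
  rewrite mulr_le0_ge0; [by []| |by lra].
  rewrite mulr_le0_ge0; [by []| |by rewrite invr_ge0; lra].
  by rewrite exprS mulr_le0_ge0 ?sqr_ge0; lra.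
- have [] := @MVT _ g (fun y => y ^+ 3 / (1 + y)) _ _ hx.
  + by move=> y; rewrite in_itv /= => /andP[h1 h2]; apply: dg; lra.
  + apply: derivable_within_continuous => y; rewrite in_itv /= => /andP[h1 h2].
    have y1 : -1 < y by lra.
    by have [] := dg _ y1.
  move=> y; rewrite in_itv /= => /andP[h1 h2]; rewrite g0 => e.
  suff : 0 <= y ^+ 3 / (1 + y) * (x - 0) by lra.
  by rewrite mulr_ge0 ?divr_ge0 ?exprn_ge0; lra.
Qed.

(** Only the constant term of a trigonometric polynomial survives in the mean over a circle. The
    last two terms are [cos (2 th)] and [sin (2 th)], written as polynomials in [cos th] and
    [sin th] to match Taylor expansions along the circle. *)
Lemma submean_trig (R : realType) (u : R * R -> R) (z : R * R)
    (rho c0 al be ga de : R) : subharmonicC u -> 0 < rho ->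
  (forall th : R, u (z.1 + rho * cos th, z.2 + rho * sin th) <=
     c0 + al * cos th + be * sin th + ga * (cos th ^+ 2 - sin th ^+ 2)
        + de * (2 * sin th * cos th)) ->
  u z <= c0.
Proof.
move=> [_ sm] rho0 ub; rewrite -lee_fin; apply: (le_trans (sm z rho rho0)).
pose F (th : R) : R := c0 * th + al * sin th - be * cos th
  + ga * (sin th * cos th) + de * sin th ^+ 2.
pose f (th : R) : R := c0 + al * cos th + be * sin th
   + ga * (cos th ^+ 2 - sin th ^+ 2) + de * (2 * sin th * cos th).
have pi0 := @pi_gt0 R.
have dF (th : R) : is_derive th 1 F (f th).
  rewrite /F; apply: is_derive_eq; rewrite /f /GRing.scale /=; ring.
have cF (th : R) : {for th, continuous F}.
  by apply: differentiable_continuous; apply/derivable1_diffP; have [] := dF th.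
have cf : continuous f.
  move=> th; rewrite /f.
  apply: (@differentiable_continuous _ _ _ _ f).
  by apply/derivable1_diffP; rewrite /f; apply: ex_derive.
have E : (\int[lebesgue_measure]_(x in `[0%R, (2 * pi)%R]) (f x)%:E)%E =
    (2 * pi * c0)%:E.
  rewrite (@continuous_FTC2 _ f F) //.
  - rewrite -EFinB /F; congr EFin.
    have -> : (2 * pi : R) = pi + pi by ring.
    rewrite sinD cosD sinpi cospi sin0 cos0; ring.
  - by lra.
  - exact: continuous_subspaceT.
  - split.
    + by move=> th _; have [] := dF th.
    + exact: (cvg_at_right_filter (cF 0)).
    + exact: (cvg_at_left_filter (cF (2 * pi))).
  - by move=> th _; rewrite derive1E; have [_] := dF th.
apply: (@le_trans _ _ (((2 * pi)^-1)%:E * (2 * pi * c0)%:E)%E); last first.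
  by rewrite -EFinM lee_fin mulrA mulVf ?mul1r // lt0r_neq0 //; lra.
rewrite -E; apply: lee_wpmul2l; first by rewrite lee_fin invr_ge0; lra.
by apply: le_integral_all => th _; rewrite lee_fin ub.
Qed.

Definition d2 {R : realType} (z w : R * R) : R :=
  (z.1 - w.1) ^+ 2 + (z.2 - w.2) ^+ 2.

Lemma near_d2 (R : realType) (z : R * R) (e : R) : 0 < e ->
  \forall w \near z, d2 z w < e ^+ 2.
Proof.
move=> e0; have h : 0 < e / 2 by lra.
near=> w.
have : ball z (e / 2) w by near: w; exact: nbhsx_ballx.
move=> [/= h1 h2]; rewrite /d2.
have k (t : R) : `|t| < e / 2 -> t ^+ 2 < (e / 2) ^+ 2.
  by move=> ht; rewrite -real_normK ?num_real// ltrXn2r// nnegrE; lra.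
have := k _ h1; have := k _ h2; nra.
Unshelve. all: by end_near. Qed.

Lemma compact_disc (R : realType) (P2 : R) :
  compact [set z : R * R | z.1 ^+ 2 + z.2 ^+ 2 <= P2].
Proof.
have S : compact (`[- (1 + `|P2|), 1 + `|P2|] `*` `[- (1 + `|P2|), 1 + `|P2|]).
  by apply: compact_setX; exact: segment_compact.
apply: (subclosed_compact _ S).
  have -> : [set z : R * R | z.1 ^+ 2 + z.2 ^+ 2 <= P2] =
    (fun z : R * R => z.1 * z.1 + z.2 * z.2) @^-1` [set x | x <= P2].
    by apply/seteqP; split => z /=; rewrite !expr2.
  apply: closed_comp; last exact: closed_le.
  move=> z _; apply: cvgD; apply: cvgM;
    by [exact: cvg_fst|exact: cvg_snd].
have k (t : R) : t ^+ 2 <= P2 -> - (1 + `|P2|) <= t <= 1 + `|P2|.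
  move=> h; have := ler_norm P2; have := normr_ge0 P2.
  by move=> ? ?; apply/andP; split; nra.
move=> [x y] /= h; split; rewrite /= in_itv /=; apply: k; nra.
Qed.

Lemma usc_max_disc (R : realType) (v : R * R -> R) (P2 : R) : 0 <= P2 ->
  (forall z (e : R), 0 < e -> \forall w \near z, v w < v z + e) ->
  exists2 z0, z0.1 ^+ 2 + z0.2 ^+ 2 <= P2 &
    forall z, z.1 ^+ 2 + z.2 ^+ 2 <= P2 -> v z <= v z0.
Proof.
move=> P0 usc; apply: contrapT => nomax.
pose K := [set z : R * R | z.1 ^+ 2 + z.2 ^+ 2 <= P2].
have cK : compact K by exact: compact_disc.
have big z : K z -> exists2 w, K w & v z < v w.
  move=> Kz; apply: contrapT => h; apply: nomax; exists z => // w Kw.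
  by rewrite leNgt; apply/negP => hlt; apply: h; exists w.
have K0 : K (0, 0) by rewrite /K /= expr0n /= addr0.
(* [F] is generated by the final segments of the levels that do not exceed some value of [v] on [K].
   Without a maximum, each point of [K] has a neighbourhood on which [v] is eventually below the
   level, and compactness yields an attained level strictly above [v] on all of [K]. *)
pose F : set_system R := fun B => exists2 z, K z & forall t, v z <= t -> 
  (exists2 w, K w & t <= v w) -> B t.
have FF : Filter F.
  split.
  - by exists (0, 0).
  - move=> A B [z1 K1 h1] [z2 K2 h2].
    case: (lerP (v z1) (v z2)) => h.
      exists z2 => // t ht hw; split; [apply: h1 => //; lra|exact: h2].
    exists z1 => // t ht hw; split; [exact: h1|apply: h2 => //; lra].
  - by move=> A B AB [z Kz hz]; exists z => // t ht hw; apply: AB; apply: hz.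
have := (compact_near_coveringP K).1 cK _ F (fun t z => v z < t) FF.
case.
  move=> z Kz; have [w Kw zw] := big z Kz.
  have e0 : 0 < (v w - v z) / 2 by lra.
  exists ([set z' | v z' < v z + (v w - v z) / 2],
          [set t | (v z + v w) / 2 <= t]).
    split => /=; first exact: usc.
    by exists w => // t ht _ /=; lra.
  by move=> [z' t] /= [h1 h2]; lra.
move=> z Kz /(_ (v z) (lexx _)) h.
have : K `<=` [set z' | v z' < v z] by apply: h; exists z.
by move=> /(_ z Kz) /=; rewrite ltxx.
Qed.

(** * Comparison with logarithmic potentials *)

(** The logarithmic potential of the points of [s], truncated on discs of squared radius [q]. Since
    [d2] is a squared distance, it is twice the usual sum of logarithms of distances. *)
Definition logpot {R : realType} (s : seq (R * R)) (q : R) (z : R * R) : R :=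
  \sum_(p <- s) ln (Num.max (d2 z p) q).

Lemma normr_le1_circle (R : realType) (t t' : R) : t ^+ 2 + t' ^+ 2 = 1 -> `|t| <= 1.
Proof. by move=> h; rewrite ler_norml; apply/andP; split; nra. Qed.

(** Off the truncation disc the logarithm is harmonic, so its second order expansion on a small
    circle is its value at the centre plus harmonics of order one and two. The coefficients come
    from expanding [ln (1 + X)] with [D * (1 + X)] the squared distance to the pole. *)
Lemma ln_max_d2_circle (R : realType) (z p : R * R) (q : R) : 0 < q -> q < d2 z p ->
  exists C del : R, [/\ 0 <= C, 0 < del & forall rho, 0 < rho < del ->
    exists al be ga de : R, forall c s : R, c ^+ 2 + s ^+ 2 = 1 ->
    ln (Num.max (d2 (z.1 + rho * c, z.2 + rho * s) p) q) <=
    ln (Num.max (d2 z p) q) + al * c + be * s + ga * (c ^+ 2 - s ^+ 2)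
      + de * (2 * s * c) + C * rho ^+ 3].
Proof.
move=> q0; rewrite /d2; set b1 := z.1 - p.1; set b2 := z.2 - p.2.
set D := b1 ^+ 2 + b2 ^+ 2 => qD.
have D0 : 0 < D by lra.
pose B := `|b1| + `|b2|.
have B0 : 0 <= B by rewrite /B addr_ge0.
pose E := (2 * B + 1) / D.
have E0 : 0 <= E by rewrite divr_ge0; lra.
(* The second bound on the radius keeps the circle outside the truncation disc; with [rho < 1] one
   has [|X| <= E * rho], whence the cubic error. *)
exists (E ^+ 3), (Num.min 1 ((D - q) / (2 * B + 1))); split.
- exact: exprn_ge0.
- by rewrite lt_min ltr01 divr_gt0 //; lra.
move=> rho; rewrite lt_min => /and3P[rho0 rho1]; rewrite ltr_pdivlMr; last lra.
move=> rhoD.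
exists ((2 * rho / D - 2 * rho ^+ 3 / D ^+ 2) * b1),
  ((2 * rho / D - 2 * rho ^+ 3 / D ^+ 2) * b2),
  (- (rho ^+ 2 * (b1 ^+ 2 - b2 ^+ 2) / D ^+ 2)),
  (- (2 * rho ^+ 2 * b1 * b2 / D ^+ 2)) => c s cs1.
pose m := b1 * c + b2 * s.
have mB : `|m| <= B.
  rewrite /m /B; apply: (le_trans (ler_normD _ _)); rewrite !normrM.
  apply: lerD; rewrite ler_piMr //; first exact: (normr_le1_circle (t' := s)).
  by apply: (normr_le1_circle (t' := c)); rewrite addrC.
have [mB1 mB2] : m <= B /\ - B <= m by move: mB; rewrite ler_norml => /andP[].
have DE : (z.1 + rho * c - p.1) ^+ 2 + (z.2 + rho * s - p.2) ^+ 2 =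
    D + 2 * rho * m + rho ^+ 2.
  transitivity (D + 2 * rho * m + rho ^+ 2 * (c ^+ 2 + s ^+ 2)).
    by rewrite /D /m /b1 /b2; ring.
  by rewrite cs1 mulr1.
rewrite /= DE.
have qD' : q < D + 2 * rho * m + rho ^+ 2 by nra.
rewrite !max_l; [|exact: ltW|exact: ltW].
pose X := (2 * rho * m + rho ^+ 2) / D.
have XE : D + 2 * rho * m + rho ^+ 2 = D * (1 + X).
  by rewrite /X; field; rewrite gt_eqF.
have X1 : 0 < 1 + X by rewrite -(pmulr_rgt0 _ D0) -XE; lra.
rewrite XE lnM ?posrE //.
have X1' : -1 < X by lra.
have := ln1p_le_cubic X1'.
have X3 : X ^+ 3 <= E ^+ 3 * rho ^+ 3.
  have Xa : `|X| <= E * rho.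
    rewrite /X /E normrM (gtr0_norm (_ : 0 < D^-1)) ?invr_gt0 //.
    rewrite [_ / D * rho]mulrAC ler_pM2r ?invr_gt0 // ler_norml; apply/andP; split; nra.
  rewrite -exprMn; apply: (le_trans (ler_norm _)); rewrite normrX.
  by apply: lerXn2r; rewrite ?nnegrE //; exact: (mulr_ge0 E0 (ltW rho0)).
(* Harmonicity is visible here: the term [rho ^+ 2 / D] of [X] cancels against the one produced by
   the mean value [D / 2] of [m ^+ 2]. *)
have Xe : X - X ^+ 2 / 2 = (2 * rho / D - 2 * rho ^+ 3 / D ^+ 2) * b1 * c +
  (2 * rho / D - 2 * rho ^+ 3 / D ^+ 2) * b2 * s
  - (rho ^+ 2 * (b1 ^+ 2 - b2 ^+ 2) / D ^+ 2) * (c ^+ 2 - s ^+ 2)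
  - (2 * rho ^+ 2 * b1 * b2 / D ^+ 2) * (2 * s * c) - rho ^+ 4 / (2 * D ^+ 2).
  have m2 : m ^+ 2 = D / 2 + (b1 ^+ 2 - b2 ^+ 2) / 2 * (c ^+ 2 - s ^+ 2)
      + b1 * b2 * (2 * s * c).
    have s2 : s ^+ 2 = 1 - c ^+ 2 by lra.
    have -> : m ^+ 2 = b1 ^+ 2 * c ^+ 2 + b2 ^+ 2 * s ^+ 2 + b1 * b2 * (2 * s * c).
      by rewrite /m; ring.
    by rewrite s2 /D; field.
  have -> : X - X ^+ 2 / 2 = 2 * rho * m / D + rho ^+ 2 / D
    - (4 * rho ^+ 2 * m ^+ 2 + 4 * rho ^+ 3 * m + rho ^+ 4) / (2 * D ^+ 2).
    by rewrite /X; field; rewrite gt_eqF.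
  by rewrite m2 /m; field; rewrite gt_eqF.
have r4 : 0 <= rho ^+ 4 / (2 * D ^+ 2).
  by rewrite divr_ge0 ?exprn_ge0 ?mulr_ge0 ?exprn_ge0 // ltW.
have E3 : 0 <= E ^+ 3 * rho ^+ 3 by rewrite mulr_ge0 ?exprn_ge0 //; lra.
lra.
Qed.

Lemma logpot_circle (R : realType) (s : seq (R * R)) (z : R * R) (q : R) : 0 < q ->
  (forall p, p \in s -> q < d2 z p) ->
  exists C del : R, [/\ 0 <= C, 0 < del & forall rho, 0 < rho < del ->
    exists al be ga de : R, forall c t : R, c ^+ 2 + t ^+ 2 = 1 ->
    logpot s q (z.1 + rho * c, z.2 + rho * t) <=
    logpot s q z + al * c + be * t + ga * (c ^+ 2 - t ^+ 2)
      + de * (2 * t * c) + C * rho ^+ 3].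
Proof.
move=> q0; rewrite /logpot; elim: s => [|p s IH] ps.
  exists 0, 1; split => // rho _; exists 0, 0, 0, 0 => c t _.
  by rewrite !big_nil !mul0r !addr0.
have [C1 [d1 [C10 d10 H1]]] := ln_max_d2_circle q0 (ps p (mem_head _ _)).
have [|C2 [d2' [C20 d20 H2]]] := IH.
  by move=> p' p's; apply: ps; rewrite inE p's orbT.
exists (C1 + C2), (Num.min d1 d2'); split.
- exact: addr_ge0.
- by rewrite lt_min d10.
move=> rho; rewrite lt_min => /and3P[r0 r1 r2].
have [|a1 [b1 [g1 [e1 h1]]]] := H1 rho; first by rewrite r0.
have [|a2 [b2 [g2 [e2 h2]]]] := H2 rho; first by rewrite r0.
exists (a1 + a2), (b1 + b2), (g1 + g2), (e1 + e2) => c t ct.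
by rewrite !big_cons; have := h1 _ _ ct; have := h2 _ _ ct; lra.
Qed.

Lemma continuous_logpot (R : realType) (s : seq (R * R)) (q : R) : 0 < q ->
  continuous (logpot s q : R * R -> R).
Proof.
move=> q0 z; rewrite /logpot; apply: cvg_big => [|p _]; first exact: add_continuous.
have cd : {for z, continuous (fun w : R * R => d2 w p : R)}.
  rewrite /d2 /=; apply: cvgD; apply: (cvg_comp _ (fun x : R => x ^+ 2));
    try exact: exprn_continuous; apply: cvgB; try exact: cvg_cst;
    by [exact: cvg_fst|exact: cvg_snd].
apply: (@continuous_comp _ _ _ (fun w : R * R => Num.max (d2 w p) q) (@ln R)).
  by apply: (@continuous_max R (R * R)%type (fun w => d2 w p) (cst q)) => //; exact: cvg_cst.
by apply: continuous_ln; rewrite lt_max q0 orbT.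
Qed.

(* A maximum point of [u - phi + eps |z|^2] off the poles would contradict the
   sub-mean inequality on small circles: the mean of [phi] exceeds its value at
   the centre by [O(rho^3)] only, while that of [eps |z|^2] gains [eps rho^2]. *)
Lemma subharmonic_le_logpot (R : realType) (u : R * R -> R) (s : seq (R * R))
    (q kap lam P2 : R) : subharmonicC u -> 0 < q -> 0 <= lam -> 0 <= P2 ->
  (forall z, z.1 ^+ 2 + z.2 ^+ 2 = P2 -> u z <= kap + lam * logpot s q z) ->
  (forall z p, z.1 ^+ 2 + z.2 ^+ 2 <= P2 -> p \in s -> d2 z p <= q ->
     u z <= kap + lam * logpot s q z) ->
  forall z, z.1 ^+ 2 + z.2 ^+ 2 <= P2 -> u z <= kap + lam * logpot s q z.
Proof.
move=> su q0 lam0 P0 bdry disc.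
pose phi z := kap + lam * logpot s q z.
have key (eps : R) z : 0 < eps -> z.1 ^+ 2 + z.2 ^+ 2 <= P2 ->
    u z <= phi z + eps * P2.
  move=> eps0 zP.
  pose v (z : R * R) := u z - phi z + eps * (z.1 ^+ 2 + z.2 ^+ 2).
  have [z0 z0P z0max] : exists2 z0, z0.1 ^+ 2 + z0.2 ^+ 2 <= P2 &
      forall z, z.1 ^+ 2 + z.2 ^+ 2 <= P2 -> v z <= v z0.
    apply: usc_max_disc => // w e e0.
    have cw : {for w, continuous (fun z : R * R =>
        - phi z + eps * (z.1 ^+ 2 + z.2 ^+ 2) : R)}.
      apply: cvgD.
        apply: cvgN; apply: cvgD; first exact: cvg_cst.
        by apply: cvgM; [exact: cvg_cst|exact: continuous_logpot].
      apply: cvgM; first exact: cvg_cst.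
      apply: cvgD; apply: (cvg_comp _ (fun x : R => x ^+ 2));
        try exact: exprn_continuous; by [exact: cvg_fst|exact: cvg_snd].
    have e2 : 0 < e / 2 by lra.
    have [del del0 hdel] := su.1 w (e / 2) e2.
    near=> w'.
    have h1 : u w' < u w + e / 2.
      apply: hdel; have : d2 w w' < del ^+ 2; last by [].
      rewrite /d2 -(opprB w'.1) -(opprB w'.2) !sqrrN -/(d2 w' w).
      rewrite (_ : d2 w' w = d2 w w'); last by rewrite /d2; ring.
      by near: w'; exact: near_d2.
    have h2 : - phi w' + eps * (w'.1 ^+ 2 + w'.2 ^+ 2) <
        (- phi w + eps * (w.1 ^+ 2 + w.2 ^+ 2)) + e / 2.
      near: w'; apply: (cvgr_lt _ cw); lra.
    rewrite /v; lra.
  have zz := z0max _ zP.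
  (* If [u] exceeds [phi] at the maximum point, the two hypotheses place that point inside the open
     disc and off the closed discs around the poles, where the circle expansion is available. *)
  have [h|h] := leP (u z0) (phi z0).
    have n0 : 0 <= eps * (z.1 ^+ 2 + z.2 ^+ 2).
      by rewrite mulr_ge0 ?addr_ge0 ?sqr_ge0 // ltW.
    have : eps * (z0.1 ^+ 2 + z0.2 ^+ 2) <= eps * P2 by rewrite ler_pM2l.
    by move: zz; rewrite /v; lra.
  exfalso.
  have z0lt : z0.1 ^+ 2 + z0.2 ^+ 2 < P2.
    rewrite lt_neqAle z0P andbT; apply/eqP => e.
    by have := bdry _ e; rewrite leNgt h.
  have z0s p : p \in s -> q < d2 z0 p.
    move=> ps; rewrite ltNge; apply/negP => hq.
    by have := disc _ _ z0P ps hq; rewrite leNgt h.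
  have [C [del [C0 del0 H]]] := logpot_circle q0 z0s.
  pose B := `|z0.1| + `|z0.2|.
  have B0 : 0 <= B by rewrite addr_ge0.
  pose g := P2 - (z0.1 ^+ 2 + z0.2 ^+ 2).
  have g0 : 0 < g by rewrite /g; lra.
  (* The three constraints: the expansion of the potential is valid, the circle stays in the disc,
     and the error [lam * C * rho ^+ 3] is smaller than the gain [eps * rho ^+ 2]. *)
  pose rho := Num.min (del / 2) (Num.min (Num.min 1 (g / (2 * B + 1)))
     (eps / (2 * (lam * C + 1)))).
  have lC : 0 <= lam * C by rewrite mulr_ge0.
  have rho0 : 0 < rho.
    by rewrite !lt_min ltr01 !divr_gt0 //; lra.
  have rhodel : rho < del.
    by apply: (@le_lt_trans _ _ (del / 2)); [rewrite ge_min lexx|lra].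
  have rho1 : rho <= 1 by rewrite !ge_min lexx !orbT.
  have rhog : rho * (2 * B + 1) <= g.
    by rewrite -ler_pdivlMr ?ge_min ?lexx ?orbT //; lra.
  have rhoe : rho * (2 * (lam * C + 1)) <= eps.
    by rewrite -ler_pdivlMr ?ge_min ?lexx ?orbT //; lra.
  have [|al [be [ga [de Hc]]]] := H rho; first by rewrite rho0.
  have : u z0 <= v z0 + phi z0 + lam * (C * rho ^+ 3)
      - eps * (z0.1 ^+ 2 + z0.2 ^+ 2 + rho ^+ 2).
    apply: (@submean_trig _ u z0 rho _ (lam * al - 2 * eps * rho * z0.1)
      (lam * be - 2 * eps * rho * z0.2) (lam * ga) (lam * de)) => // th.
    have ct := cos2Dsin2 th.
    set w := (z0.1 + _, _).
    have wE : w.1 ^+ 2 + w.2 ^+ 2 = z0.1 ^+ 2 + z0.2 ^+ 2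
        + 2 * rho * (z0.1 * cos th + z0.2 * sin th) + rho ^+ 2.
      transitivity (z0.1 ^+ 2 + z0.2 ^+ 2
        + 2 * rho * (z0.1 * cos th + z0.2 * sin th)
        + rho ^+ 2 * (cos th ^+ 2 + sin th ^+ 2)); first by rewrite /w /=; ring.
      by rewrite ct mulr1.
    have mB : z0.1 * cos th + z0.2 * sin th <= B.
      apply: lerD; apply: (le_trans (ler_norm _)); rewrite normrM ler_piMr //.
        exact: (normr_le1_circle (t' := sin th)).
      by apply: (normr_le1_circle (t' := cos th)); rewrite addrC.
    have wP : w.1 ^+ 2 + w.2 ^+ 2 <= P2.
      rewrite wE; move: rhog; rewrite /g; nra.
    have vw := z0max _ wP.
    have := Hc _ _ ct; rewrite -/w => /(ler_wpM2l lam0) Hw.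
    have : u w = v w + phi w - eps * (w.1 ^+ 2 + w.2 ^+ 2) by rewrite /v; ring.
    rewrite wE /phi => ->; lra.
  have : lam * C * rho ^+ 3 < eps * rho ^+ 2.
    rewrite exprS mulrA ltr_pM2r ?exprn_gt0 //; nra.
  rewrite /v; lra.
move=> z zP; rewrite leNgt; apply/negP => h.
(* With this [eps] the correction [eps * P2] is at most half of the supposed excess; [P2 + 1] keeps
   the denominator positive when [P2] is 0. *)
have := key ((u z - phi z) / (2 * (P2 + 1))) z.
have d0 : 0 < u z - phi z by rewrite /phi; lra.
move=> /(_ (divr_gt0 d0 _) zP).
have e : (u z - phi z) / (2 * (P2 + 1)) * P2 <= (u z - phi z) / 2.
  have -> : (u z - phi z) / (2 * (P2 + 1)) * P2 = (u z - phi z) / 2 * (P2 / (P2 + 1)).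
    by field; rewrite gt_eqF //; lra.
  by apply: ler_piMr; [lra|rewrite ler_pdivrMr; lra].
have : 0 < 2 * (P2 + 1) by lra.
move=> p2 /(_ p2); lra.
Unshelve. all: by end_near. Qed.

(** * Three circles and Harnack chains *)

Lemma subharmonicC_affine (R : realType) (u : R * R -> R) (b : R * R) (s : R) :
  0 < s -> subharmonicC u ->
  subharmonicC (fun z => u (b.1 + s * z.1, b.2 + s * z.2)).
Proof.
move=> s0 [usc sm]; split.
  move=> z e e0.
  have [del del0 h] := usc (b.1 + s * z.1, b.2 + s * z.2) e e0.
  exists (del / s); first exact: divr_gt0.
  move=> w; rewrite expr_div_n ltr_pdivlMr ?exprn_gt0 // => hw.
  by apply: h => /=; lra.
move=> z rho rho0.
have := sm (b.1 + s * z.1, b.2 + s * z.2) (s * rho) (mulr_gt0 s0 rho0).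
move=> /le_trans; apply; rewrite le_eqVlt; apply/orP; left; apply/eqP; congr (_ * _)%E.
by apply: eq_integral => th _; congr (EFin (u _)); congr pair => /=; ring.
Qed.

(** One pole at the centre, with the weight for which the majorant equals [M] on the outer circle
    and [M - K] on the inner disc. All radii are squared, which leaves the quotient of logarithms
    unchanged. *)
Lemma three_circles (R : realType) (u : R * R -> R) (M K p2 P2 : R) (z : R * R) :
  subharmonicC u -> 0 <= K -> 0 < p2 < P2 ->
  (forall w : R * R, w.1 ^+ 2 + w.2 ^+ 2 <= p2 -> u w <= M - K) ->
  (forall w : R * R, w.1 ^+ 2 + w.2 ^+ 2 <= P2 -> u w <= M) ->
  p2 <= z.1 ^+ 2 + z.2 ^+ 2 <= P2 ->
  u z <= M - K * (ln (P2 / (z.1 ^+ 2 + z.2 ^+ 2)) / ln (P2 / p2)).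
Proof.
move=> su K0 /andP[p0 pP] hin hout /andP[z1 z2].
have L0 : 0 < ln (P2 / p2) by rewrite ln_gt0 // ltr_pdivlMr ?mul1r.
have P0 : 0 < P2 by lra.
pose lam := K / ln (P2 / p2).
have lam0 : 0 <= lam by rewrite divr_ge0 // ltW.
have lE w : logpot [:: (0, 0)] p2 w = ln (Num.max (w.1 ^+ 2 + w.2 ^+ 2) p2).
  by rewrite /logpot big_seq1 /d2 /= !subr0.
have := @subharmonic_le_logpot R u [:: (0, 0)] p2 (M - lam * ln P2) lam P2
  su p0 lam0 (ltW P0) _ _ z z2.
rewrite lE max_l //.
have -> : ln (P2 / (z.1 ^+ 2 + z.2 ^+ 2)) = ln P2 - ln (z.1 ^+ 2 + z.2 ^+ 2).
  by rewrite ln_div // posrE; lra.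
move=> h; apply: (le_trans (h _ _)).
- move=> w wP; rewrite lE wP max_l; last exact: ltW.
  by rewrite subrK; apply: hout; rewrite wP.
- move=> w p wP; rewrite inE => /eqP ->; rewrite lE /d2 /= !subr0 => wp.
  rewrite max_r //; apply: (le_trans (hin _ wp)).
  have : lam * ln (P2 / p2) = K by rewrite /lam divfK // gt_eqF.
  by rewrite ln_div ?posrE //; lra.
- by rewrite (_ : K * _ = lam * (ln P2 - ln (z.1 ^+ 2 + z.2 ^+ 2))); [lra|rewrite /lam; ring].
Qed.

(** Otherwise [u] would drop by [3 * C] on the disc of radius [e]; three circles with radii [e],
    [2 * e], [4 * e] transmits at least half of this drop to [p], and [3 * C / 2] exceeds [C]. *)
Lemma harnack_step (R : realType) (u : R * R -> R) (M C e : R) (p q : R * R) :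
  subharmonicC u -> 0 < C -> 0 < e ->
  (forall w : R * R, d2 w q <= (4 * e) ^+ 2 -> u w <= M) ->
  d2 p q <= (2 * e) ^+ 2 -> M - C <= u p ->
  exists2 z, d2 z q <= e ^+ 2 & M - 3 * C <= u z.
Proof.
move=> su C0 e0 hM pq up; apply: contrapT => hno.
have hlt z : d2 z q <= e ^+ 2 -> u z <= M - 3 * C.
  move=> hz; rewrite leNgt; apply/negP => h; apply: hno; exists z => //; lra.
have [h|h] := leP (d2 p q) (e ^+ 2); first by have := hlt _ h; lra.
have sv := subharmonicC_affine q ltr01 su.
have e2 : 0 < e ^+ 2 by rewrite exprn_gt0.
have H : u p <= M - 3 * C * (ln ((4 * e) ^+ 2 / d2 p q) / ln ((4 * e) ^+ 2 / e ^+ 2)).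
  have := @three_circles R _ M (3 * C) (e ^+ 2) ((4 * e) ^+ 2)
    (p.1 - q.1, p.2 - q.2) sv.
  rewrite /= !mul1r [q.1 + _]addrC [q.2 + _]addrC !subrK -surjective_pairing; apply.
  - lra.
  - by rewrite e2 exprMn; lra.
  - move=> w hw; apply: hlt; rewrite /d2 /= !mul1r [q.1 + _]addrC [q.2 + _]addrC.
    by rewrite !addrK.
  - move=> w hw; apply: hM; rewrite /d2 /= !mul1r [q.1 + _]addrC [q.2 + _]addrC.
    by rewrite !addrK.
  - apply/andP; split; first exact: ltW.
    by apply: (le_trans pq); rewrite !exprMn; lra.
have l4 : 0 < ln 4 :> R by rewrite ln_gt0 //; lra.
have l16 : ln ((4 * e) ^+ 2 / e ^+ 2) = 2 * ln (4 : R).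
  have -> : (4 * e) ^+ 2 / e ^+ 2 = 4 ^+ 2 by field; rewrite gt_eqF.
  by rewrite lnXn // mulr_natl.
have lr : ln (4 : R) <= ln ((4 * e) ^+ 2 / d2 p q).
  have d0 : 0 < d2 p q by lra.
  rewrite ler_ln ?posrE ?divr_gt0 ?exprn_gt0 ?mulr_gt0 //.
  by rewrite ler_pdivlMr //; move: pq; rewrite !exprMn; lra.
have : 1 / 2 <= ln ((4 * e) ^+ 2 / d2 p q) / ln ((4 * e) ^+ 2 / e ^+ 2).
  by rewrite l16 ler_pdivlMr; lra.
move=> ht; have := ler_wpM2l (ltW C0) ht; move: H.
set t := ln _ / ln _; lra.
Qed.

(* The triangle inequality in a form that can be summed termwise. *)
Lemma sqrD_le_weighted (R : realType) (r s : R) : 0 < r -> 0 < s -> forall x y : R,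
  (x + y) ^+ 2 <= (1 + s / r) * x ^+ 2 + (1 + r / s) * y ^+ 2.
Proof.
move=> r0 s0 x y; rewrite -subr_ge0.
have -> : (1 + s / r) * x ^+ 2 + (1 + r / s) * y ^+ 2 - (x + y) ^+ 2 =
  (s * x - r * y) ^+ 2 / (r * s) by field; rewrite !gt_eqF.
by rewrite divr_ge0 ?sqr_ge0 // mulr_ge0 // ltW.
Qed.

Lemma d2_triangle (R : realType) (a b c : R * R) (r s : R) : 0 < r -> 0 < s ->
  d2 a b <= r ^+ 2 -> d2 b c <= s ^+ 2 -> d2 a c <= (r + s) ^+ 2.
Proof.
move=> r0 s0; rewrite /d2 => h1 h2.
have k := sqrD_le_weighted r0 s0.
have k1 := k (a.1 - b.1) (b.1 - c.1); have k2 := k (a.2 - b.2) (b.2 - c.2).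
have sr : 0 < s / r by rewrite divr_gt0.
have rs : 0 < r / s by rewrite divr_gt0.
have e : (r + s) ^+ 2 = (1 + s / r) * r ^+ 2 + (1 + r / s) * s ^+ 2.
  by field; rewrite !gt_eqF.
rewrite e; move: k1 k2; rewrite !addrA !subrK => k1 k2.
have := ler_wpM2l (ltW (_ : 0 < 1 + s / r)) h1.
have := ler_wpM2l (ltW (_ : 0 < 1 + r / s)) h2.
lra.
Qed.

(** Centres are placed at equal spacing at most [e] on the segment. A point within [e] of one centre
    is within [2 * e] of the next, so [harnack_step] applies again, and each step triples the
    loss. *)
Lemma harnack_chain (R : realType) (u : R * R -> R) (M C e : R) (p q : R * R)
    (k : nat) :
  subharmonicC u -> 0 < C -> 0 < e ->
  (forall (t : R) (w : R * R), 0 <= t <= 1 ->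
     d2 w (p.1 + t * (q.1 - p.1), p.2 + t * (q.2 - p.2)) <= (4 * e) ^+ 2 ->
     u w <= M) ->
  d2 p q <= (k%:R * e) ^+ 2 -> M - C <= u p ->
  exists2 z, d2 z q <= e ^+ 2 & M - 3 ^+ k * C <= u z.
Proof.
move=> su C0 e0 hM pq up.
pose y (i : nat) : R * R :=
  (p.1 + i%:R / k%:R * (q.1 - p.1), p.2 + i%:R / k%:R * (q.2 - p.2)).
have [k0|k0] := posnP k.
  exists p; last by rewrite k0 expr0 mul1r.
  by apply: (le_trans pq); rewrite k0 mul0r expr0n /= sqr_ge0.
have k0' : 0 < k%:R :> R by rewrite ltr0n.
have yk : y k = q.
  rewrite /y divff ?gt_eqF // !mul1r ![p.1 + _]addrC ![p.2 + _]addrC !subrK.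
  by rewrite -surjective_pairing.
rewrite -yk.
suff : forall i, (i <= k)%N -> exists2 z, d2 z (y i) <= e ^+ 2 & M - 3 ^+ i * C <= u z.
  by apply.
elim=> [_|i IH ik].
  exists p; last by rewrite expr0 mul1r.
  by rewrite /y /d2 /= !mul0r !addr0 !subrr expr0n /= addr0 sqr_ge0.
have [z zy uz] := IH (ltnW ik).
have t01 : 0 <= (i.+1%:R / k%:R : R) <= 1.
  by rewrite divr_ge0 //= ler_pdivrMr // mul1r ler_nat.
have c3 : 0 < 3 ^+ i * C by rewrite mulr_gt0 // exprn_gt0.
have [z' h1 h2] : exists2 z', d2 z' (y i.+1) <= e ^+ 2 & M - 3 * (3 ^+ i * C) <= u z'.
  apply: (harnack_step su c3 e0 _ _ uz); first by move=> w; apply: hM.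
  rewrite (_ : 2 * e = e + e); last by ring.
  apply: (d2_triangle e0 e0 zy).
  have -> : d2 (y i) (y i.+1) = d2 p q / k%:R ^+ 2.
    rewrite /y /d2 /= -natr1; field; by rewrite gt_eqF.
  by rewrite ler_pdivrMr ?exprn_gt0 // -exprMn [e * _]mulrC.
by exists z' => //; rewrite exprS -mulrA.
Qed.

(** * A discrete Remez inequality *)

Lemma card_set_near_le (R : realType) (L : nat) (A : {set 'I_L}) (x D : R) : 0 <= D ->
  (forall j, j \in A -> `|x - j%:R| <= D) -> #|A|%:R <= 2 * D + 1.
Proof.
move=> D0 hA.
have [->|[j1 j1A]] := set_0Vmem A; first by rewrite cards0; lra.
have [j0 j0A jmin] := arg_minnP (fun j : 'I_L => j : nat) j1A.
pose m := Num.trunc (2 * D).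
pose f (j : 'I_L) : 'I_m.+1 := inord (j - j0).
have jm j : j \in A -> (j - j0 < m.+1)%N.
  move=> jA; rewrite ltnS truncn_ge_nat; last lra.
  rewrite natrB; last exact: jmin.
  have := hA _ jA; have := hA _ j0A.
  by rewrite !ler_norml => /andP[? ?] /andP[? ?]; lra.
have finj : {in A &, injective f}.
  move=> j j' jA j'A /(congr1 val) /=; rewrite !inordK ?jm // => e.
  by apply: val_inj; have := jmin _ jA; have := jmin _ j'A; move: e => /=; lia.
have : (#|A| <= m.+1)%N.
  by rewrite -(card_in_imset finj); apply: (leq_trans (max_card _)); rewrite card_ord.
rewrite -(ler_nat R) => /le_trans; apply; rewrite -natr1 lerD2r.
by rewrite truncn_le; lra.
Qed.

Lemma mul_ln_succ_le (R : realType) (t : R) : 1 <= t -> t * (ln (t + 1) - ln t) <= 1.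
Proof.
move=> t1; have t0 : 0 < t by lra.
rewrite -ln_div ?posrE //; last by lra.
have -> : (t + 1) / t = 1 + t^-1 by field; rewrite gt_eqF.
rewrite -[leRHS](divff (_ : t != 0)) ?gt_eqF // ler_pM2l //; apply: le_ln1Dx.
by have : 0 < t^-1; [rewrite invr_gt0|lra].
Qed.

(** The analogue of [ln N! >= N ln N - N] for integers in any position. Remove the point farthest
    from [x]: all the others lie within its distance, so by [card_set_near_le] that distance is at
    least about half of the cardinal, and its term pays for the increment of [N ln N]. *)
Lemma sum_ln_dist_ge (R : realType) (L : nat) (A : {set 'I_L}) (x : R) :
  #|A|%:R * ln #|A|%:R - (1 + ln 4) * #|A|%:R <=
  \sum_(j in A) ln (Num.max `|x - j%:R| 1).
Proof.
have [N] := ubnP #|A|; elim: N A => // N IH A; rewrite ltnS => AN.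
have [->|[j1 j1A]] := set_0Vmem A; first by rewrite cards0 big_set0; lra.
have [j0 j0A jmax] : exists2 j0, j0 \in A &
    forall j, j \in A -> `|x - j%:R| <= `|x - j0%:R|.
  by have [j0 ? ?] := Order.TotalTheory.arg_maxP (fun j : 'I_L => `|x - j%:R|) j1A; exists j0.
rewrite (big_setD1 j0) //=.
have cA : #|A| = #|A :\ j0|.+1 by rewrite (cardsD1 j0) j0A.
have {}IH := IH (A :\ j0) _.
rewrite cA in AN *.
have := IH AN; move: (\sum_(j in _) _) => S.
have := card_set_near_le (normr_ge0 _) jmax.
rewrite cA; move: `|x - j0%:R| #|A :\ j0| => D n; rewrite -natr1 => nD hS.
set N1 : R := n%:R in nD hS *.
have N10 : 0 <= N1 by rewrite ler0n.
have l1 : 0 <= ln (Num.max D 1) by rewrite ln_ge0 // le_max lexx orbT.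
have [n0|n0] := posnP n.
  have l4 : 0 <= ln (4 : R) by apply: ln_ge0; lra.
  by move: hS l1; rewrite /N1 n0 add0r ln1; lra.
have N11 : 1 <= N1 by rewrite /N1 ler1n.
have h1 := mul_ln_succ_le N11.
have h2 : ln (N1 + 1) - ln 4 <= ln (Num.max D 1).
  rewrite -ln_div ?posrE; [|lra|lra].
  rewrite ler_ln ?posrE; [|apply: divr_gt0; lra|by rewrite lt_max ltr01 orbT].
  by rewrite le_max ler_pdivrMr; [|lra]; apply/orP; left; lra.
lra.
Qed.

(** Put poles at the [N] nodes, truncated at radius [eta]. The potential is at least [2 N ln 7] on
    the circle of radius 8, at most [2 N ln 2] at [z], and everywhere at least
    [2 N (ln (N eta) - 1 - ln 4)] by [sum_ln_dist_ge]. The weight [lam] makes the majorant [M] at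
    the first level and [M - K] at the last, whose difference is [2 N ln (28 e / (N eta))];
    evaluating it at [z] gives the factor [ln (7 / 2)]. *)
Lemma discrete_remez (R : realType) (u : R * R -> R) (M K C s0 eta : R) (L : nat)
    (A : {set 'I_L}) (z : R * R) :
  subharmonicC u -> 0 < K -> 0 < C -> 0 < eta <= 1 ->
  (forall w : R * R, w.1 ^+ 2 + w.2 ^+ 2 <= 8 ^+ 2 -> u w <= M) ->
  (0 < #|A|)%N ->
  (forall j, j \in A -> `|s0 + eta * j%:R| <= 1) ->
  (forall j (w : R * R), j \in A -> d2 w (s0 + eta * j%:R, 0) <= eta ^+ 2 ->
     u w <= M - K) ->
  z.1 ^+ 2 + z.2 ^+ 2 <= 1 -> M - C <= u z ->
  K <= C * (ln (28 * expR 1 / (#|A|%:R * eta)) / ln (7 / 2)).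
Proof.
move=> su K0 C0 /andP[eta0 eta1] hM A0 hA hK z1 uz.
set N : R := #|A|%:R.
have N0 : 0 < N by rewrite ltr0n.
(* The nodes lie in an interval of length 2 with spacing [eta]. This bound makes the logarithm [Lam]
   positive, so that the weight below is well defined. *)
have Neta : N * eta <= 3.
  have /(card_set_near_le _) : forall j, j \in A -> `|- s0 / eta - j%:R| <= eta^-1.
    move=> j jA; have -> : - s0 / eta - j%:R = - ((s0 + eta * j%:R) / eta).
      by field; rewrite gt_eqF.
    rewrite normrN normrM (gtr0_norm (_ : 0 < eta^-1)) ?invr_gt0 //.
    by rewrite ler_piMl ?invr_ge0 ?hA // ltW.
  rewrite invr_ge0 ltW // => /(_ isT).
  rewrite -(ler_pM2r eta0) mulrDl -mulrA mulVf ?gt_eqF //; rewrite -/N; lra.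
have Ne0 : 0 < N * eta by rewrite mulr_gt0.
pose Lam : R := ln (28 * expR 1 / (N * eta)).
have e1 : 1 <= expR 1 :> R by have := expR_ge1Dx (1 : R); lra.
have Lam0 : 0 < Lam.
  by rewrite ln_gt0 // ltr_pdivlMr //; lra.
have LamE : Lam = ln 7 + ln 4 + 1 - ln N - ln eta.
  rewrite /Lam ln_div ?posrE ?mulr_gt0 ?expR_gt0 // (_ : 28 = 7 * 4); last ring.
  rewrite !lnM ?posrE ?mulr_gt0 ?expR_gt0 // expRK; ring.
pose s : seq (R * R) := [seq (s0 + eta * j%:R, 0) | j : 'I_L <- enum A].
have potE w : logpot s (eta ^+ 2) w =
    \sum_(j in A) ln (Num.max (d2 w (s0 + eta * j%:R, 0)) (eta ^+ 2)).
  by rewrite /logpot /s big_map big_enum.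
have e20 : 0 < eta ^+ 2 by rewrite exprn_gt0.
have low w : 2 * (N * (ln N + ln eta - 1 - ln 4)) <= logpot s (eta ^+ 2) w.
  rewrite potE.
  pose x := (w.1 - s0) / eta.
  have := sum_ln_dist_ge A x; rewrite -/N => hs.
  have : \sum_(j in A) (2 * (ln eta + ln (Num.max `|x - j%:R| 1))) <=
    \sum_(j in A) ln (Num.max (d2 w (s0 + eta * j%:R, 0)) (eta ^+ 2)).
    apply: ler_sum => j jA.
    have m0 : 0 < Num.max `|x - j%:R| 1 by rewrite lt_max ltr01 orbT.
    rewrite -lnM ?posrE // mulr_natl -lnXn ?mulr_gt0 //.
    rewrite ler_ln ?posrE; [|exact: exprn_gt0 (mulr_gt0 eta0 m0)|by rewrite lt_max e20 orbT].
    have [h|h] := leP `|x - j%:R| 1.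
      by rewrite mulr1 le_max lexx orbT.
    rewrite le_max; apply/orP; left; rewrite exprMn real_normK ?num_real //.
    rewrite -exprMn mulrBr /x mulrC divfK ?gt_eqF // /d2 /= subr0.
    have := sqr_ge0 w.2; have -> : w.1 - s0 - eta * j%:R = w.1 - (s0 + eta * j%:R) by ring.
    lra.
  rewrite -mulr_sumr big_split /= sumr_const -mulr_natr -/N; lra.
pose lam := K / (2 * N * Lam).
have lam0 : 0 <= lam by rewrite ltW // divr_gt0 // !mulr_gt0.
have lamE : lam * (2 * N * Lam) = K by rewrite /lam divfK // gt_eqF // !mulr_gt0.
have e49 : ln (7 ^+ 2) = 2 * ln (7 : R) by rewrite lnXn // mulr_natl.
have l72 : 0 < ln (7 / 2 : R) by rewrite ln_gt0 //; lra.
have huz : u z <= M - lam * (N * (2 * ln 7)) + lam * logpot s (eta ^+ 2) z.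
  apply: (subharmonic_le_logpot su e20 lam0 (sqr_ge0 (8 : R))); last by lra.
  - move=> w wP; apply: (le_trans (hM _ _)); first by rewrite wP.
    suff : N * (2 * ln 7) <= logpot s (eta ^+ 2) w.
      by move=> /(ler_wpM2l lam0); lra.
    rewrite potE -e49 mulrC /N mulr_natr -sumr_const; apply: ler_sum => j jA.
    rewrite ler_ln ?posrE ?exprn_gt0 ?lt_max ?e20 ?orbT // le_max.
    apply/orP; left; rewrite /d2 /= subr0.
    have := hA _ jA; rewrite ler_norml => /andP[h1 h2].
    move: wP; set t := s0 + _ in h1 h2 * => wP.
    have w1 : -8 <= w.1 <= 8 by have := sqr_ge0 w.2; move=> ?; apply/andP; split; nra.
    have -> : (w.1 - t) ^+ 2 + w.2 ^+ 2 = w.1 ^+ 2 + w.2 ^+ 2 - 2 * t * w.1 + t ^+ 2.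
      by ring.
    move: w1 => /andP[w1 w1']; rewrite wP.
    have [t0|t0] := leP 0 t.
      have := ler_wpM2l t0 w1'; nra.
    have := ler_wnM2l (ltW t0) w1; nra.
  - move=> w p wP /mapP[j]; rewrite mem_enum => jA -> wj.
    apply: (le_trans (hK _ _ jA wj)).
    have := ler_wpM2l lam0 (low w); rewrite LamE in lamE; lra.
have up : logpot s (eta ^+ 2) z <= N * (2 * ln 2).
  rewrite potE (_ : 2 * ln 2 = ln (2 ^+ 2)); last by rewrite lnXn // mulr_natl.
  rewrite mulrC /N mulr_natr -sumr_const; apply: ler_sum => j jA.
  rewrite ler_ln ?posrE ?exprn_gt0 ?lt_max ?e20 ?orbT // ge_max.
  apply/andP; split; last by rewrite expr2; nra.
  rewrite (_ : 2 = 1 + 1); last by [].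
  apply: (@d2_triangle _ _ (0, 0)) => //; rewrite /d2 /= !subr0 expr1n //.
  by rewrite sub0r sqrrN expr0n /= addr0 -real_normK ?num_real // expr_le1 ?hA.
have := ler_wpM2l lam0 up => hup.
have lE : ln (7 / 2 : R) = ln 7 - ln 2 by rewrite ln_div ?posrE.
rewrite -/Lam mulrA ler_pdivlMr // lE.
have hh : lam * N * 2 * (ln 7 - ln 2) <= C by lra.
rewrite -lamE -lE; rewrite -lE in hh.
have := ler_wpM2r (ltW Lam0) hh; lra.
Qed.

(** * Complex lines and the class F_r *)

Definition subC {R : realType} {n : nat} (z w : Cn R n) : Cn R n :=
  (fun i => z.1 i - w.1 i, fun i => z.2 i - w.2 i).

Definition norm2C {R : realType} {n : nat} (w : Cn R n) : R :=
  \sum_(i < n) (w.1 i ^+ 2 + w.2 i ^+ 2).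

Lemma dist2C_ge0 (R : realType) (n : nat) (z w : Cn R n) : 0 <= dist2C z w.
Proof. by apply: sumr_ge0 => i _; rewrite addr_ge0 ?sqr_ge0. Qed.

Lemma dist2CC (R : realType) (n : nat) (z w : Cn R n) : dist2C z w = dist2C w z.
Proof. by apply: eq_bigr => i _; ring. Qed.

Lemma dist2C_triangle (R : realType) (n : nat) (a b c : Cn R n) (r s : R) :
  0 < r -> 0 < s ->
  dist2C a c <= (1 + s / r) * dist2C a b + (1 + r / s) * dist2C b c.
Proof.
move=> r0 s0; rewrite /dist2C !mulr_sumr -big_split /=; apply: ler_sum => i _.
have k := sqrD_le_weighted r0 s0.
have := k (a.1 i - b.1 i) (b.1 i - c.1 i); have := k (a.2 i - b.2 i) (b.2 i - c.2 i).
by rewrite !addrA !subrK; lra.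
Qed.

Lemma dist2C_le_lt (R : realType) (n : nat) (a b c : Cn R n) (r s : R) :
  0 < r -> 0 < s -> dist2C a b <= r ^+ 2 -> dist2C b c < s ^+ 2 ->
  dist2C a c < (r + s) ^+ 2.
Proof.
move=> r0 s0 h1 h2; apply: (le_lt_trans (dist2C_triangle a b c r0 s0)).
have e : (r + s) ^+ 2 = (1 + s / r) * r ^+ 2 + (1 + r / s) * s ^+ 2.
  by field; rewrite !gt_eqF.
rewrite e; apply: ler_ltD.
  by apply: ler_wpM2l => //; rewrite addr_ge0 ?divr_ge0 // ltW.
by rewrite ltr_pM2l // addr_gt0 ?divr_gt0.
Qed.

Lemma dist2C_lt_le (R : realType) (n : nat) (a b c : Cn R n) (r s : R) :
  0 < r -> 0 < s -> dist2C a b < r ^+ 2 -> dist2C b c <= s ^+ 2 ->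
  dist2C a c < (r + s) ^+ 2.
Proof.
move=> r0 s0 h1 h2; rewrite dist2CC addrC; apply: (@dist2C_le_lt _ _ _ b) => //;
  by rewrite dist2CC.
Qed.

Lemma dist2C_cline (R : realType) (n : nat) (z w : Cn R n) (a b : R * R) :
  dist2C (cline z w a) (cline z w b) = d2 a b * norm2C w.
Proof. by rewrite /dist2C /norm2C mulr_sumr; apply: eq_bigr => i _; rewrite /d2 /=; ring. Qed.

Lemma cline0 (R : realType) (n : nat) (z w : Cn R n) : cline z w (0, 0) = z.
Proof. by case: z => z1 z2; congr pair; apply/funext => i /=; ring. Qed.

Lemma cline_subC (R : realType) (n : nat) (x z : Cn R n) : cline x (subC z x) (1, 0) = z.
Proof. by case: z => z1 z2; congr pair; apply/funext => i /=; ring. Qed.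

Lemma norm2C_subC (R : realType) (n : nat) (x z : Cn R n) : norm2C (subC z x) = dist2C x z.
Proof. by apply: eq_bigr => i _ /=; ring. Qed.

Lemma dist2C_cline0 (R : realType) (n : nat) (z w : Cn R n) (a : R * R) :
  dist2C z (cline z w a) = (a.1 ^+ 2 + a.2 ^+ 2) * norm2C w.
Proof. by rewrite -{1}(cline0 z w) dist2C_cline /d2 /=; ring. Qed.

(** On the complex line through [x] and [z], parametrised with [z] at 1, all radii are divided by
    [|z - x|] and their ratios persist. *)
Lemma three_circles_Cn (R : realType) (n : nat) (f : Cn R n -> R) (x z : Cn R n)
    (M K p P : R) : psh f -> 0 <= K -> 0 < p -> p < P ->
  (forall y, dist2C x y <= p ^+ 2 -> f y <= M - K) ->
  (forall y, dist2C x y <= P ^+ 2 -> f y <= M) ->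
  p ^+ 2 <= dist2C x z <= P ^+ 2 ->
  f z <= M - K * (ln (P ^+ 2 / dist2C x z) / ln (P ^+ 2 / p ^+ 2)).
Proof.
move=> [_ hf] K0 p0 pP hin hout /andP[z1 z2].
have p20 : 0 < p ^+ 2 by rewrite exprn_gt0.
have D0 : 0 < dist2C x z by lra.
have pP2 : p ^+ 2 < P ^+ 2 by rewrite ltrXn2r ?nnegrE //; lra.
have := @three_circles R _ M K (p ^+ 2 / dist2C x z) (P ^+ 2 / dist2C x z) (1, 0)
  (hf x (subC z x)) K0.
rewrite /= cline_subC expr1n expr0n /= addr0 divr1.
rewrite (_ : P ^+ 2 / dist2C x z / (p ^+ 2 / dist2C x z) = P ^+ 2 / p ^+ 2); last first.
  by field; rewrite !gt_eqF.
apply.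
- by rewrite divr_gt0 //= ltr_pM2r ?invr_gt0.
- by move=> w hw; apply: hin; rewrite dist2C_cline0 norm2C_subC -ler_pdivlMr.
- by move=> w hw; apply: hout; rewrite dist2C_cline0 norm2C_subC -ler_pdivlMr.
- by rewrite ler_pdivrMr // mul1r z1 ler_pdivlMr // mul1r.
Qed.

Lemma dist2C_convex (R : realType) (n : nat) (c x z : Cn R n) (t : R) (q : R) :
  0 <= t <= 1 -> dist2C c x < q -> dist2C c z < q ->
  dist2C c (cline x (subC z x) (t, 0)) < q.
Proof.
move=> /andP[t0 t1] h1 h2.
apply: (@le_lt_trans _ _ ((1 - t) * dist2C c x + t * dist2C c z)); last first.
  have [->|tn] := eqVneq t 0; first by rewrite mul0r addr0 subr0 mul1r.
  have t0' : 0 < t by rewrite lt_def tn.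
  have : t * dist2C c z < t * q by rewrite ltr_pM2l.
  have : (1 - t) * dist2C c x <= (1 - t) * q by apply: ler_wpM2l; lra.
  lra.
rewrite /dist2C !mulr_sumr -big_split /=; apply: ler_sum => i _.
have k (u v w : R) : (u - (v + t * (w - v))) ^+ 2 <=
    (1 - t) * (u - v) ^+ 2 + t * (u - w) ^+ 2.
  have -> : (u - (v + t * (w - v))) ^+ 2 = (1 - t) * (u - v) ^+ 2 +
    t * (u - w) ^+ 2 - t * (1 - t) * (v - w) ^+ 2 by ring.
  have : 0 <= t * (1 - t) * (v - w) ^+ 2.
    by apply: mulr_ge0 (sqr_ge0 _); apply: mulr_ge0 => //; lra.
  lra.
have := k (c.1 i) (x.1 i) (z.1 i); have := k (c.2 i) (x.2 i) (z.2 i).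
rewrite !mul0r !subr0 !addr0; lra.
Qed.

Notation orig := (realpt (fun=> 0)).

Lemma classF_le0 (R : realType) (n : nat) (r : R) (f : Cn R n -> R) z :
  classF r f -> dist2C orig z < r ^+ 2 -> f z <= 0.
Proof.
move=> [_ [h _]] hz; suff : ((f z)%:E <= 0)%E by rewrite lee_fin.
by rewrite -h; apply: ereal_sup_ubound; exists z.
Qed.

(** The value -2 replaces -1 because the supremum over the open ball may not be attained. *)
Lemma classF_point (R : realType) (n : nat) (r : R) (f : Cn R n -> R) :
  classF r f -> exists2 z, dist2C orig z < 1 & -2 <= f z.
Proof.
move=> [_ [_ h]]; apply: contrapT => hno.
have : (ereal_sup [set (f z)%:E | z in ballC (realpt (fun=> 0%R)) 1] <= (-2)%:E)%E.
  apply: ge_ereal_sup => _ [z hz <-]; rewrite lee_fin leNgt; apply/negP => hlt.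
  by apply: hno; exists z; [move: hz; rewrite /ballC /= expr1n|lra].
by move=> /(le_trans h); rewrite -EFinN lee_fin; lra.
Qed.

(** A Harnack chain along the segment from the point of [classF_point] to [x]. The segment lies in
    the unit ball, so its neighbourhood of width [(r - 1) / 2] stays where [f <= 0]. *)
Lemma classF_near_point (R : realType) (r : R) : 1 < r ->
  exists2 C : R, 0 < C & forall n (f : Cn R n -> R) x, classF r f ->
    dist2C orig x < 1 ->
    exists2 z, dist2C x z <= ((r - 1) / 8) ^+ 2 & - C <= f z.
Proof.
move=> r1; pose rho := r - 1; have rho0 : 0 < rho by rewrite /rho; lra.
(* The segment has length at most 2 and is covered in steps of length [rho / 8], so the number of
   steps depends on [r] only. *)
pose k := (Num.trunc (16 / rho)).+1.
exists (3 ^+ k * 2); first by rewrite mulr_gt0 // exprn_gt0.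
move=> n f x Ff x1; have [zs zs1 fzs] := classF_point Ff.
pose D := dist2C x zs.
have [D0|D0] := leP D 0.
  exists zs; first by rewrite (le_trans D0) // sqr_ge0.
  have : 1 <= 3 ^+ k :> R by rewrite exprn_ege1 //; lra.
  lra.
have D4 : D <= 2 ^+ 2.
  rewrite (_ : 2 = 1 + 1); last by [].
  apply/ltW/(@dist2C_lt_le _ _ _ orig); rewrite ?ltr01 ?expr1n //; last exact: ltW.
  by rewrite dist2CC.
pose s := Num.sqrt D; have s0 : 0 < s by rewrite sqrtr_gt0.
have sD : s ^+ 2 = D by rewrite sqr_sqrtr // ltW.
have s2 : s <= 2 by rewrite -(ler_pXn2r (_ : 0 < 2)%N) ?nnegrE ?sD //; apply: ltW.
pose e := rho / 8 / s.
have e0 : 0 < e by rewrite !divr_gt0.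
have eD : e ^+ 2 * D = (rho / 8) ^+ 2 by rewrite -sD /e; field; rewrite gt_eqF.
have [|||z hz fz] := @harnack_chain R (fun t => f (cline x (subC zs x) t)) 0 2 e
    (1, 0) (0, 0) k (Ff.1.2 _ _) (ltr0Sn R 1) e0 _ _ _.
- move=> t w /andP[t0 t1] /=; rewrite sub0r subrr mulr0 addr0 mulrN1 => hw.
  have hc : dist2C orig (cline x (subC zs x) (1 - t, 0)) < 1.
    by apply: dist2C_convex => //; apply/andP; split; lra.
  apply: (classF_le0 Ff).
  have -> : r = 1 + rho by rewrite /rho; ring.
  apply: (dist2C_lt_le ltr01 rho0 (_ : dist2C _ _ < _)); first by rewrite expr1n; exact: hc.
  rewrite dist2C_cline norm2C_subC -/D; apply: (le_trans (y := (4 * e) ^+ 2 * D)).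
    rewrite ler_pM2r //; move: hw; rewrite /d2 /=; lra.
  by rewrite exprMn -mulrA eD; nra.
- rewrite /d2 /= !subr0 expr1n expr0n /= addr0 -[leLHS](expr1n _ 2).
  apply: lerXn2r; rewrite ?nnegrE ?ler01 //; first exact: mulr_ge0 (ler0n _ _) (ltW e0).
  have : 16 / rho <= k%:R by rewrite ltW // truncnS_gt.
  rewrite ler_pdivrMr // => hk.
  have -> : k%:R * e = k%:R * rho / 8 / s by rewrite /e; ring.
  by rewrite ler_pdivlMr //; lra.
- by rewrite cline_subC; lra.
exists (cline x (subC zs x) z); last by lra.
rewrite -/rho dist2C_cline0 norm2C_subC -/D -eD ler_pM2r //.
by move: hz; rewrite /d2 /= !subr0.
Qed.

Lemma ltr_sqr2 (R : realType) (x y : R) : 0 <= x -> x < y -> x ^+ 2 < y ^+ 2.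
Proof. by move=> ? ?; nra. Qed.

Lemma ler_sqr2 (R : realType) (x y : R) : 0 <= x -> x <= y -> x ^+ 2 <= y ^+ 2.
Proof. by move=> ? ?; nra. Qed.

(** If [T > 1], both [x + e_0] and [x - e_0] lie in the unit ball, whereas their squared norms add
    up to at least 2. *)
Lemma ball_sub_unit_le1 (R : realType) (n : nat) (x : Cn R n) (T : R) : (0 < n)%N ->
  0 < T -> (forall z, dist2C x z < T ^+ 2 -> dist2C orig z < 1) -> T <= 1.
Proof.
case: n x => // n x _ T0 hT; rewrite leNgt; apply/negP => T1.
pose y (s : R) : Cn R n.+1 := (fun i => x.1 i + s * (i == ord0)%:R, x.2).
have sum0 (s : R) : \sum_(i < n.+1) s * (i == ord0)%:R = s.
  rewrite (bigD1 ord0) //= ?eqxx mulr1 big1 ?addr0 // => i /negbTE ->.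
  by rewrite mulr0.
have hy (s : R) : s ^+ 2 = 1 -> dist2C orig (y s) < 1.
  move=> s1; apply: hT; apply: (@le_lt_trans _ _ 1).
    rewrite -[leRHS](sum0 1) le_eqVlt; apply/orP; left; apply/eqP.
    apply: eq_bigr => i _ /=; case: (i == ord0) => /=.
      by rewrite mulr1 mulr1 -s1; ring.
    by rewrite !mulr0; ring.
  by rewrite -[ltLHS](expr1n _ 2) ltrXn2r ?nnegrE // ltW.
have h1 := hy 1 (expr1n _ 2); have h2 := hy (-1) (etrans (sqrrN 1) (expr1n _ 2)).
have : \sum_(i < n.+1) 2 * (i == ord0)%:R <= dist2C orig (y 1) + dist2C orig (y (-1)).
  rewrite /dist2C -big_split /=; apply: ler_sum => i _.
  have := sqr_ge0 (x.1 i); have := sqr_ge0 (x.2 i).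
  by case: (i == ord0); rewrite ?mulr1n ?mulr0n /=; lra.
rewrite sum0; lra.
Qed.

(** The difficulty is uniformity in [t]: when [T = a * t] is small, [M] can be very negative, while
    outside the ball only [f <= 0] is available. Three circles with radii [t / 4], [T],
    [T + rho / 2] and the bound 0 outside yield [(C - 1) * Z <= (1 - M) * l], where
    [Z = ln ((T + rho / 2) / T)] and [l = ln (4 * a)]. Hence [- M] must grow at most linearly in
    [Z], which is [Mlow]. *)
Lemma doubling (R : realType) (a r : R) : 1 < a -> 1 < r ->
  exists2 C : R, 0 < C & forall n (f : Cn R n -> R) x (t M : R), (0 < n)%N ->
    classF r f -> 0 < t ->
    (forall z, dist2C x z < (a * t) ^+ 2 -> dist2C orig z < 1) ->
    (forall z, dist2C x z < (a * t) ^+ 2 -> f z <= M) -> M <= 0 ->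
    (exists2 w, dist2C x w < (a * t) ^+ 2 & M - 1 <= f w) ->
    exists2 z, dist2C x z <= (t / 4) ^+ 2 & M - C <= f z.
Proof.
move=> a1 r1; have [C1 C10 HC1] := @classF_near_point R r r1.
pose rho := r - 1; have rho0 : 0 < rho by rewrite /rho; lra.
pose l : R := ln (4 * a); have l0 : 0 < l by rewrite ln_gt0; lra.
pose Z0 : R := ln (1 + rho / 2); have Z00 : 0 < Z0 by rewrite ln_gt0; lra.
pose l16 : R := ln 16; have l160 : 0 < l16 by rewrite ln_gt0; lra.
have q1 : 0 < l * (1 + C1) / Z0 by rewrite !divr_gt0 ?mulr_gt0 //; lra.
have q2 : 0 < 4 * l * C1 / l16 by rewrite !divr_gt0 ?mulr_gt0.
(* The two fractions are what the bound on [(1 - M) * l / Z] costs; the summand 2 leaves a strict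
   margin for the final contradiction. *)
pose C := 2 + l * (1 + C1) / Z0 + 4 * l * C1 / l16.
exists C; first by rewrite /C; lra.
move=> n f x t M n0 Ff t0 hsub hM M0 [w xw fw].
pose T := a * t; have T0 : 0 < T by rewrite mulr_gt0 //; lra.
have T1 : T <= 1 by exact: (ball_sub_unit_le1 n0 T0 hsub).
(* The segment from [x] to [z] contains a point [y] of the ball of radius [T], hence of the unit
   ball, at distance less than [rho] from [z]. *)
have out z : dist2C x z < (T + rho) ^+ 2 -> f z <= 0.
  move=> hz; apply: (classF_le0 Ff).
  pose y := cline x (subC z x) (T / (T + rho), 0).
  have Tr : 0 < T + rho by lra.
  have hy : dist2C x y < T ^+ 2.
    rewrite dist2C_cline0 norm2C_subC /= expr0n /= addr0.
    have -> : T ^+ 2 = (T / (T + rho)) ^+ 2 * (T + rho) ^+ 2.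
      by field; rewrite gt_eqF.
    by rewrite ltr_pM2l // exprn_gt0 // divr_gt0.
  have -> : r = 1 + rho by rewrite /rho; ring.
  apply: (dist2C_le_lt ltr01 rho0 (_ : dist2C _ y <= _)).
    by rewrite expr1n; apply/ltW/hsub.
  rewrite -[z in dist2C y z](cline_subC x) dist2C_cline norm2C_subC /d2 /= subrr.
  have -> : rho ^+ 2 = (T / (T + rho) - 1) ^+ 2 * (T + rho) ^+ 2.
    by field; rewrite gt_eqF.
  rewrite expr0n /= addr0 ltr_pM2l // exprn_even_gt0 //= -(subr0 0) -subr_eq0.
  have -> : T / (T + rho) - 1 = - (rho / (T + rho)) by field; rewrite gt_eqF.
  by rewrite !subr0 oppr_eq0 gt_eqF // divr_gt0.
pose Z : R := ln (1 + rho / (2 * T)).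
have rT : 0 < rho / (2 * T) by rewrite divr_gt0 // mulr_gt0.
have Z0Z : Z0 <= Z.
  rewrite /Z0 /Z ler_ln ?posrE; [|lra|lra].
  rewrite lerD2l ler_pM2l // lef_pV2 ?posrE ?mulr_gt0 //; lra.
have ZZ : 0 < Z by apply: lt_le_trans Z0Z.
(* Three circles around [x] with radii [T / 2], [|z1 - x|], [rho / 2]: since [f z1 >= - C1] at a
   distance at most [rho / 8], the maximum on the small ball decreases at most logarithmically in
   [T]. If [z1] is already in the ball of radius [T], then [M >= - C1] directly. *)
have Mlow : - M <= C1 * (1 + 4 * Z / l16).
  have x1 : dist2C orig x < 1.
    by apply: hsub; rewrite -(cline0 x x) dist2C_cline /d2 /= subrr expr0n /= addr0 mul0r exprn_gt0.
  have [z1 xz1 fz1] := HC1 n f x Ff x1.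
  have zl : 0 <= C1 * (4 * Z / l16).
    by apply: mulr_ge0 (ltW C10) _; apply: divr_ge0 (ltW l160); apply: mulr_ge0 (ltW ZZ).
  have [h|h] := ltP (dist2C x z1) (T ^+ 2); first by have := hM _ h; move: fz1 zl; clear; lra.
  have Tr8 : T <= rho / 8.
    rewrite -(ler_pXn2r (_ : 0 < 2)%N) ?nnegrE //; first exact: le_trans xz1.
      exact: ltW.
    by apply: ltW; lra.
  have D0 : 0 < dist2C x z1 by rewrite (lt_le_trans _ h) // exprn_gt0.
  have : f z1 <= 0 - (- M) * (ln ((rho / 2) ^+ 2 / dist2C x z1)
      / ln ((rho / 2) ^+ 2 / (T / 2) ^+ 2)).
    apply: (three_circles_Cn Ff.1).
    - lra.
    - lra.
    - lra.
    - move=> y hy; rewrite sub0r opprK; apply: hM; apply: (le_lt_trans hy).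
      by rewrite -/T; apply: ltr_sqr2; lra.
    - move=> y hy; apply: out; apply: (le_lt_trans hy).
      by apply: ltr_sqr2; move: T0 rho0; clear; lra.
    - apply/andP; split.
        by apply: (le_trans _ h); apply: ler_sqr2; move: T0; clear; lra.
      by apply: (le_trans xz1); rewrite -/rho; apply: ler_sqr2; lra.
  set A := ln _; set B := ln _ => hz.
  have A16 : l16 <= A.
    have pp : 0 < (rho / 2) ^+ 2 / dist2C x z1 by rewrite divr_gt0 // exprn_gt0 // divr_gt0.
    rewrite /l16 /A ler_ln ?posrE //.
    by rewrite ler_pdivlMr //; move: xz1; rewrite -/rho !expr_div_n; lra.
  have B4 : B <= 4 * Z.
    rewrite /B /Z mulr_natl -lnXn; last lra.
    have p1 : 0 < (rho / 2) ^+ 2 / (T / 2) ^+ 2.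
      by apply: divr_gt0; apply: exprn_gt0; apply: divr_gt0.
    have p2 : 0 < (1 + rho / (2 * T)) ^+ 4 by apply: exprn_gt0; lra.
    rewrite ler_ln ?posrE //.
    have -> : (rho / 2) ^+ 2 / (T / 2) ^+ 2 = (rho / T) ^+ 2 by field; rewrite gt_eqF.
    have q0 : 0 < rho / T by apply: divr_gt0.
    rewrite -[4%N]/(2 * 2)%N exprM; apply: ler_sqr2; first exact: ltW.
    have -> : rho / (2 * T) = rho / T / 2 by field; rewrite gt_eqF.
    by move: q0; set q := rho / T; nra.
  have B0 : 0 < B.
    have p2 : 0 < (T / 2) ^+ 2 by apply: exprn_gt0; apply: divr_gt0.
    rewrite /B ln_gt0 // ltr_pdivlMr // mul1r.
    by apply: ltr_sqr2; lra.
  have hAB : - M * A <= C1 * B.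
    by rewrite -ler_pdivrMr // -mulrA; move: hz fz1; clear; lra.
  have : - M * l16 <= C1 * (4 * Z).
    apply: (@le_trans _ _ (- M * A)); first by apply: ler_wpM2l => //; move: M0; clear; lra.
    by apply: (le_trans hAB); apply: ler_wpM2l => //; exact: ltW.
  rewrite -ler_pdivlMr // -mulrA; lra.
apply: contrapT => hno.
have hin y : dist2C x y <= (t / 4) ^+ 2 -> f y <= 0 - (C - M).
  move=> hy; rewrite leNgt; apply/negP => h; apply: hno; exists y => //; lra.
have tT : t < T by rewrite /T; nra.
have [h|h] := leP (dist2C x w) ((t / 4) ^+ 2).
  by have := hin _ h; rewrite /C in q1 q2 *; lra.
have D0 : 0 < dist2C x w by rewrite (le_lt_trans _ h) // sqr_ge0.
have : f w <= 0 - (C - M) * (ln ((T + rho / 2) ^+ 2 / dist2C x w)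
    / ln ((T + rho / 2) ^+ 2 / (t / 4) ^+ 2)).
  apply: (three_circles_Cn Ff.1).
  - rewrite /C; lra.
  - lra.
  - lra.
  - exact: hin.
  - move=> y hy; apply: out; apply: (le_lt_trans hy).
    by apply: ltr_sqr2; move: T0 rho0; clear; lra.
  - apply/andP; split; first exact: ltW.
    by apply: ltW; apply: (lt_le_trans xw); apply: ler_sqr2; rewrite -/T; lra.
have -> : ln ((T + rho / 2) ^+ 2 / (t / 4) ^+ 2) = 2 * (Z + l).
  have -> : (T + rho / 2) ^+ 2 / (t / 4) ^+ 2 = ((1 + rho / (2 * T)) * (4 * a)) ^+ 2.
    by rewrite /T; field; rewrite !gt_eqF //; lra.
  rewrite lnXn; last by apply: mulr_gt0; lra.
  by rewrite lnM ?posrE; [rewrite [RHS]mulr_natl|lra|lra].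
set A := ln _ => hw.
have A2 : 2 * Z <= A.
  rewrite /Z mulr_natl -lnXn; last lra.
  have p1 : 0 < (T + rho / 2) ^+ 2 / dist2C x w.
    by apply: divr_gt0 => //; apply: exprn_gt0; lra.
  have p2 : 0 < (1 + rho / (2 * T)) ^+ 2 by apply: exprn_gt0; lra.
  rewrite /A ler_ln ?posrE //.
  rewrite ler_pdivlMr //; apply: (@le_trans _ _ ((1 + rho / (2 * T)) ^+ 2 * T ^+ 2)).
    by rewrite ler_pM2l; [exact: ltW|apply: exprn_gt0; lra].
  by rewrite -exprMn (_ : (1 + rho / (2 * T)) * T = T + rho / 2) //; field; rewrite gt_eqF.
have CM : 0 < C - M by rewrite /C; lra.
have hAB : (C - M) * A <= (1 - M) * (2 * (Z + l)).
  by rewrite -ler_pdivrMr; [rewrite -mulrA; lra|lra].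
have h2 : (C - M) * (2 * Z) <= (C - M) * A by rewrite ler_pM2l.
have h3 : (C - 1) * Z <= (1 - M) * l by lra.
have h4 : (1 - M) * l <= (1 + C1) * l + C1 * l * (4 * Z / l16).
  have := ler_wpM2r (ltW l0) Mlow; lra.
have h5 : (1 + C1) * l <= l * (1 + C1) / Z0 * Z.
  rewrite mulrAC ler_pdivlMr // mulrC mulrC [_ * l]mulrC; apply: ler_wpM2l => //.
  by rewrite mulr_ge0 //; lra.
have : (C - 1) * Z <= l * (1 + C1) / Z0 * Z + 4 * l * C1 / l16 * Z.
  have -> : 4 * l * C1 / l16 * Z = C1 * l * (4 * Z / l16) by ring.
  lra.
rewrite -mulrDl ler_pM2r // /C; lra.
Qed.

Lemma dist2C_lt (R : realType) (n : nat) (a b c : Cn R n) (r s q : R) :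
  0 < r -> 0 < s -> r + s < q -> dist2C a b <= r ^+ 2 -> dist2C b c <= s ^+ 2 ->
  dist2C a c < q ^+ 2.
Proof.
move=> r0 s0 rsq h1 h2.
have h3 : dist2C b c < (q - r) ^+ 2 by apply: (le_lt_trans h2); apply: ltr_sqr2; lra.
by rewrite (_ : q = r + (q - r)); [apply: (dist2C_le_lt r0 _ h1 h3); lra|ring].
Qed.

(** Each point of the segment has a disc where [v] stays below [m]; compactness supplies a common
    radius, as the equal discs of [discrete_remez] require. *)
Lemma usc_uniform_segment (R : realType) (v : R * R -> R) (m : R) : uscC1 v ->
  (forall s : R, -1 <= s <= 1 -> v (s, 0) < m) ->
  exists N : nat, forall (s : R) (w : R * R), -1 <= s <= 1 ->
    d2 w (s, 0) <= (N.+1%:R^-1) ^+ 2 -> v w <= m.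
Proof.
move=> usc hv.
have loc (s : R) : -1 <= s <= 1 -> exists2 del : R, 0 < del &
    forall (s' e : R) (w : R * R), `|s - s'| < del -> 0 < e -> e < del ->
      d2 w (s', 0) <= e ^+ 2 -> v w <= m.
  move=> hs; have e0 : 0 < m - v (s, 0) by have := hv _ hs; lra.
  have [del del0 hdel] := usc (s, 0) _ e0.
  exists (del / 2) => [|s' e w h1 he0 h2 hw]; first by lra.
  apply: ltW; rewrite -[m](subrKC (v (s, 0))); apply: hdel => /=.
  (* [d2_triangle] takes positive radii, hence the separate value [del / 4] when the two points
     coincide. *)
  have [dd [dd0 dd1 dd2]] : exists dd : R, [/\ 0 < dd, dd < del / 2 & d2 (s', 0) (s, 0) <= dd ^+ 2].
    have [ss|ss] := eqVneq s s'.
      by exists (del / 4); rewrite ss /d2 /= !subrr expr0n /= addr0 sqr_ge0; split => //; lra.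
    exists `|s - s'|; split => //; first by rewrite normr_gt0 subr_eq0.
    by rewrite real_normK ?num_real // /d2 /=; lra.
  have h3 := d2_triangle he0 dd0 hw dd2.
  have : (e + dd) ^+ 2 < del ^+ 2 by apply: ltr_sqr2; lra.
  move: h3; rewrite /d2 /=; lra.
have := (compact_near_coveringP _).1 (@segment_compact R (-1) 1) _ \oo
  (fun N s => forall w : R * R, d2 w (s, 0) <= (N.+1%:R^-1) ^+ 2 -> v w <= m) _.
case.
  move=> s; rewrite /= in_itv /= => /loc [del del0 hdel].
  exists ([set s' | `|s - s'| < del], [set N | (N.+1%:R^-1 : R) < del]).
    split => /=; last exact: (near_infty_natSinv_lt (PosNum del0)).
    exact: (nbhsx_ballx s _ del0).
  move=> [s' N] /= [h1 h2] w hw.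
  by apply: (hdel _ _ _ h1 _ h2 hw); rewrite invr_gt0 ltr0n.
move=> N _ /(_ N (leqnn N)) h; exists N => s w hs hw.
by apply: (h s) => //; rewrite /= in_itv.
Qed.

(** For [z = p + i q] the line [p + zeta q] passes through [z] at [zeta = i] and is real for real
    [zeta]. A Harnack chain goes from [i] to the disc of radius [tau] around 0, where
    [tau |q| = e t]. If [f] were small on the whole real segment [[-tau, tau]], the Remez inequality
    with nodes filling that segment would contradict the value just found. *)
Lemma real_point (R : realType) (a C : R) : 1 < a -> 0 < C ->
  exists2 C' : R, 0 < C' & forall n (f : Cn R n -> R) (x : Rn R n) (t M : R) z,
    psh f -> 0 < t ->
    (forall z, dist2C (realpt x) z < (a * t) ^+ 2 -> f z <= M) ->
    dist2C (realpt x) z <= (t / 4) ^+ 2 -> M - C <= f z ->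
    exists2 y : Rn R n, dist2R x y < t ^+ 2 & M - C' <= f (realpt y).
Proof.
(* The first bound keeps discs of size [8 * e * t] inside the ball of radius [a * t], the second
   keeps the real segment inside the ball of radius [t]. *)
move=> a1 C0; pose e := Num.min ((a - 1) / 8) (1 / 4).
have e0 : 0 < e by rewrite lt_min; apply/andP; split; lra.
have [e8 e4] : e <= (a - 1) / 8 /\ e <= 1 / 4.
  by split; rewrite ge_min lexx ?orbT.
pose k := (Num.trunc e^-1).+1.
have ke : 1 <= k%:R * e by rewrite -ler_pdivrMr // div1r; apply/ltW/truncnS_gt.
pose C3 := 3 ^+ k * C; have C30 : 0 < C3 by rewrite mulr_gt0 // exprn_gt0.
pose lam : R := ln (28 * expR 1 / 2) / ln (7 / 2).
have e1 : 1 <= expR 1 :> R by have := expR_ge1Dx (1 : R); lra.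
have lam0 : 0 < lam by rewrite divr_gt0 // ln_gt0; lra.
have lamC : 0 < C3 * lam by rewrite mulr_gt0.
exists (C + (C3 * lam + 1)); first by lra.
move=> n f x t M z pf t0 hM xz fz.
pose p : Rn R n := z.1; pose q : Rn R n := z.2.
have xzE : dist2C (realpt x) z = dist2R x p + norm2C (realpt q).
  by rewrite -big_split /=; apply: eq_bigr => i _ /=; rewrite /p /q; ring.
have xpE : dist2C (realpt x) (realpt p) = dist2R x p.
  by apply: eq_bigr => i _ /=; ring.
have xp0 : 0 <= dist2R x p by rewrite -xpE dist2C_ge0.
have q0 : 0 <= norm2C (realpt q).
  by apply: sumr_ge0 => i _; rewrite addr_ge0 ?sqr_ge0.
have t4 : (t / 4) ^+ 2 < t ^+ 2 by apply: ltr_sqr2; lra.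
have [qq|qq] := leP (norm2C (realpt q)) 0.
  have q00 i : q i = 0.
    apply/eqP; rewrite -sqrf_eq0; apply/eqP/le_anti; rewrite sqr_ge0 andbT.
    apply: le_trans qq; rewrite /norm2C (bigD1 i) //= expr0n /= addr0 lerDl.
    by apply: sumr_ge0 => j _; rewrite addr_ge0 ?sqr_ge0.
  exists p; first by lra.
  have -> : realpt p = z by rewrite [RHS]surjective_pairing; congr pair; apply/funext => i; exact/esym/q00.
  lra.
pose s := Num.sqrt (norm2C (realpt q)); have s0 : 0 < s by rewrite sqrtr_gt0.
have sE : s ^+ 2 = norm2C (realpt q) by rewrite sqr_sqrtr // ltW.
have st : s <= t / 4.
  by rewrite -(ler_pXn2r (_ : 0 < 2)%N) ?nnegrE //; [lra|exact: ltW|lra].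
pose tau := e * t / s.
have tau0 : 0 < tau by rewrite divr_gt0 // mulr_gt0.
have taus (c : R) : (c * tau) ^+ 2 * norm2C (realpt q) = (c * e * t) ^+ 2.
  by rewrite -sE /tau; field; rewrite gt_eqF.
pose u := fun b => f (cline (realpt p) (realpt q) b).
have su : subharmonicC u by exact: pf.2.
have et : 0 < e * t by rewrite mulr_gt0.
have et1 : e * t <= (a - 1) / 8 * t by rewrite ler_pM2r.
have et2 : e * t <= 1 / 4 * t by rewrite ler_pM2r.
have uM (b b' : R * R) : dist2C (realpt x) (cline (realpt p) (realpt q) b') <= (t / 4) ^+ 2 ->
    d2 b b' <= (8 * tau) ^+ 2 -> u b <= M.
  move=> hb' hb; apply: hM.
  apply: (dist2C_lt (r := t / 4) (s := 8 * e * t) _ _ _ hb').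
  - by move: t0; clear; lra.
  - by move: et; clear; lra.
  - by move: et1 t0; clear; lra.
  rewrite dist2C_cline -taus ler_pM2r //; move: hb; rewrite /d2; lra.
have [b hb ub] : exists2 b, d2 b (0, 0) <= tau ^+ 2 & M - C3 <= u b.
  apply: (harnack_chain (p := (0, 1)) su C0 tau0).
  - move=> h w /andP[h0 h1] /= hw; apply: (uM _ _ _ (le_trans hw _)).
      have -> : dist2C (realpt x) (cline (realpt p) (realpt q)
         (0 + h * (0 - 0), 1 + h * (0 - 1))) =
         dist2R x p + (1 - h) ^+ 2 * norm2C (realpt q).
        rewrite /dist2R /norm2C mulr_sumr -big_split; apply: eq_bigr => i _ /=; ring.
      apply: le_trans xz; rewrite xzE lerD2l ler_piMl //.
      by rewrite -[leRHS](expr1n _ 2); apply: ler_sqr2; move: h0 h1; clear; lra.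
    by apply: ler_sqr2; move: tau0; clear; lra.
  - rewrite /d2 /= subr0 expr0n /= add0r subr0; apply: ler_sqr2 => //.
    rewrite /tau mulrA ler_pdivlMr // mul1r mulrA.
    have := ler_wpM2r (ltW t0) ke; lra.
  - rewrite /u; have -> : cline (realpt p) (realpt q) (0, 1) = z.
      by rewrite [RHS]surjective_pairing; congr pair; apply/funext => i /=; rewrite /p /q; ring.
    exact: fz.
clearbody tau; apply: contrapT => hno.
pose o : R * R := (0, 0).
pose v := fun w : R * R => u (o.1 + tau * w.1, o.2 + tau * w.2).
have sv : subharmonicC v by exact: subharmonicC_affine.
have vE (w : R * R) : v w = u (tau * w.1, tau * w.2) by rewrite /v /= !add0r.
have pp : dist2C (realpt x) (cline (realpt p) (realpt q) (0, 0)) <= (t / 4) ^+ 2.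
  by rewrite cline0 xpE; lra.
have [|N hN] := usc_uniform_segment (m := M - (C3 * lam + 1)) sv.1.
  move=> h /andP[h0 h1]; rewrite vE /= ltNge; apply/negP => hge; apply: hno.
  exists (fun i => p i + tau * h * q i).
    apply: (@le_lt_trans _ _ (dist2C (realpt x) (cline (realpt p) (realpt q) (tau * h, 0)))).
      by rewrite /dist2R /dist2C; apply: ler_sum => i _ /=; nra.
    apply: (dist2C_lt (r := t / 4) (s := e * t) _ _ _ (b := realpt p)) => //.
    - by move: t0; clear; lra.
    - by move: t0 et2; clear; lra.
    - by move: xz xzE q0 xpE; clear; lra.
    rewrite dist2C_cline0 /= expr0n /= addr0 mulrC mulrC (mulrC tau) taus.
    rewrite -mulrA exprMn ler_piMl ?sqr_ge0 //; move: h0 h1; clear; nra.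
  have -> : realpt (fun i => p i + tau * h * q i) = cline (realpt p) (realpt q) (tau * h, 0).
    by congr pair; apply/funext => i /=; ring.
  by move: hge; rewrite /u mulr0; lra.
pose eta : R := N.+1%:R^-1.
have eta0 : 0 < eta by rewrite invr_gt0 ltr0n.
have etaN : N.+1%:R * eta = 1 by rewrite /eta divff // pnatr_eq0.
have eta1 : eta <= 1 by rewrite /eta invf_le1 ?ltr0n // ler1n.
(* These nodes give [N * eta = 2] whatever the radius found by compactness, so the Remez bound is
   the fixed number [C3 * lam]. *)
pose A : {set 'I_(2 * N.+1)} := [set: 'I_(2 * N.+1)]%SET.
have cA : #|A| = (2 * N.+1)%N by rewrite cardsT card_ord.
have As (j : 'I_(2 * N.+1)) : -1 <= -1 + eta * j%:R <= 1.
  have j0 : 0 <= eta * j%:R by rewrite mulr_ge0 ?ler0n // ltW.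
  have : eta * j%:R <= eta * (2 * N.+1%:R).
    by rewrite ler_pM2l // -natrM ler_nat ltnW.
  by move: j0 etaN; clear => ? ? ?; apply/andP; split; lra.
pose b' := (b.1 / tau, b.2 / tau).
have := @discrete_remez R v M (C3 * lam + 1) C3 (-1) eta _ A b' sv _ C30 _ _ _ _ _ _ _.
have -> : ln (28 * expR 1 / (#|A|%:R * eta)) / ln (7 / 2) = lam.
  by rewrite cA natrM -[_ * _ * eta]mulrA etaN mulr1.
suff : C3 * lam + 1 <= C3 * lam -> False.
  move=> nle H; apply: nle; apply: H.
  - lra.
  - by rewrite eta0.
  - move=> w hw; rewrite vE; apply: (uM _ (0, 0) pp); rewrite /d2 /= !subr0.
    have := ler_wpM2l (sqr_ge0 tau) hw; clear; lra.
  - by rewrite cA.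
  - by move=> j _; rewrite ler_norml As.
  - by move=> j w _ hw; apply: (hN (-1 + eta * j%:R)) => //; exact: As.
  - move: hb; rewrite /d2 /b' /= !subr0 !expr_div_n -mulrDl => hb.
    by rewrite ler_pdivrMr ?exprn_gt0 // mul1r.
  - rewrite vE.
    suff -> : (tau * b'.1, tau * b'.2) = b by [].
    by rewrite [RHS]surjective_pairing /b' /=; congr pair; field; rewrite gt_eqF.
lra.
Qed.

(** * Dyadic cells and averaging over segments *)

(** The index of the half-open cube of side [2 ^- k] containing [p]; half-open cubes of two levels
    are nested or disjoint. *)
Definition dyadic {R : realType} {n : nat} (k : nat) (p : Rn R n) : {ffun 'I_n -> int} :=
  [ffun i => Num.floor (2 ^+ k * p i)].

Lemma dyadicP (R : realType) (n k : nat) (p : Rn R n) (J : {ffun 'I_n -> int}) :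
  dyadic k p = J <-> forall i, (J i)%:~R <= 2 ^+ k * p i < (J i + 1)%:~R.
Proof.
split=> [<- i|h]; first by rewrite ffunE floor_itv.
by apply/ffunP => i; rewrite ffunE; apply: floor_def.
Qed.

Lemma dyadic_nested (R : realType) (n k k' : nat) (p p' : Rn R n) : (k <= k')%N ->
  dyadic k' p = dyadic k' p' -> dyadic k p = dyadic k p'.
Proof.
move=> kk' e; apply/dyadicP => i; rewrite ffunE.
have := (dyadicP k' p _).1 e i; rewrite ffunE.
have := floor_itv (2 ^+ k' * p' i).
move: (Num.floor (2 ^+ k' * p' i)) => z; have := floor_itv (2 ^+ k * p' i).
move: (Num.floor (2 ^+ k * p' i)) => c /andP[c1 c2] /andP[z1 z2] /andP[z3 z4].
rewrite -(subnK kk') in z1 z2 z3 z4; move: (k' - k)%N => m in z1 z2 z3 z4.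
rewrite exprD in z1 z2 z3 z4.
have m0 : 0 < 2 ^+ m :> R by rewrite exprn_gt0.
have e2 : (2 ^+ m : R) = ((2 ^ m)%:Z)%:~R by rewrite -natrX.
have cz : c * (2 ^ m)%:Z < z + 1.
  rewrite -(ltr_int R) intrM -e2; apply: le_lt_trans z2.
  by rewrite -mulrA mulrC ler_pM2l.
have zc : z < (c + 1) * (2 ^ m)%:Z.
  rewrite -(ltr_int R) intrM -e2; apply: (le_lt_trans z1).
  by rewrite -mulrA mulrC ltr_pM2r.
apply/andP; split.
  rewrite -(ler_pM2l m0) mulrA; apply: le_trans z3; rewrite mulrC e2 -intrM ler_int.
  by rewrite -ltzD1.
rewrite -(ltr_pM2l m0) mulrA; apply: (lt_le_trans z4); rewrite mulrC e2 -intrM ler_int.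
by rewrite lezD1.
Qed.

(** Every point of [om] lies in a coarsest cell satisfying [P]. These cells are pairwise disjoint
    and countably many, and they cover [om]; if all finite subfamilies had volume at most [V], so
    would the whole cover. *)
Lemma dyadic_cover (R : realType) (n : nat) (om : set (Rn R n))
    (P : nat -> {ffun 'I_n -> int} -> Prop) (V : R) : (0 < n)%N ->
  (forall p, om p -> exists k, P k (dyadic k p)) -> (V%:E < leb_outer om)%E ->
  exists s : seq (nat * {ffun 'I_n -> int}), [/\ uniq s,
    forall c, c \in s -> P c.1 c.2,
    forall c c' (p : Rn R n), c \in s -> c' \in s ->
      dyadic c.1 p = c.2 -> dyadic c'.1 p = c'.2 -> c = c' &
    V < \sum_(c <- s) (2 ^- c.1) ^+ n].
Proof.
move=> n0 hP hV; pose T : countType := (nat * {ffun 'I_n -> int})%type.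
pose isnew (c : T) := `[< P c.1 c.2 /\ exists p : Rn R n, dyadic c.1 p = c.2 /\
  forall k, (k < c.1)%N -> ~ P k (dyadic k p) >].
have disj c c' (p : Rn R n) : isnew c -> isnew c' ->
    dyadic c.1 p = c.2 -> dyadic c'.1 p = c'.2 -> c = c'.
  wlog cc' : c c' / (c.1 <= c'.1)%N.
    move=> wl nc nc' h h'; case/orP: (leq_total c.1 c'.1) => hc; first exact: wl.
    by apply/esym/wl.
  move=> /asboolP[Pc _] /asboolP[_ [p' [ep' hp']]] h h'.
  move: cc'; rewrite leq_eqVlt => /orP[/eqP e|lt].
    by rewrite [c]surjective_pairing [c']surjective_pairing -h -h' e.
  exfalso; apply: (hp' _ lt); rewrite (@dyadic_nested _ _ _ c'.1 p' p) ?h //.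
    exact: ltnW.
  by rewrite ep' h'.
(* Enumeration of the maximal cells by their codes. An index that codes none yields the box reduced
   to the origin, of volume 0 because [n] is positive. *)
pose g (m : nat) : option T := if pickle_inv m is Some c then
  (if isnew c then Some c else None) else None.
have gK : ocancel g pickle.
  move=> m; rewrite /g; have := @pickle_invK T m.
  by case: (pickle_inv m) => [c|] //=; case: (isnew c).
pose A m : Rn R n := if g m is Some c then (fun i => (c.2 i)%:~R / 2 ^+ c.1) else (fun=> 0).
pose B m : Rn R n := if g m is Some c then (fun i => ((c.2 i)%:~R + 1) / 2 ^+ c.1) else (fun=> 0).
pose s N : seq T := pmap g (iota 0 N).
have snew N c : c \in s N -> isnew c.
  rewrite mem_pmap => /mapP[m _]; rewrite /g.
  by case: pickle_inv => // c'; case: ifP => // nc' [->].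
apply: contrapT => hno; move: hV; apply/negP; rewrite -leNgt.
have volE m : vol (A m) (B m) = if g m is Some c then (2 ^- c.1) ^+ n else 0.
  rewrite /vol /A /B; case: (g m) => [c|].
    rewrite (eq_bigr (fun=> 2 ^- c.1)) ?prodr_const ?card_ord // => i _.
    by rewrite -mulrBl addrC addKr mul1r.
  by rewrite prodr_const card_ord subrr expr0n gtn_eqF.
have vol0 m : 0 <= vol (A m) (B m).
  by rewrite volE; case: (g m) => // c; rewrite exprn_ge0 // invr_ge0 exprn_ge0.
have psum N : \sum_(0 <= m < N) vol (A m) (B m) = \sum_(c <- s N) (2 ^- c.1) ^+ n.
  rewrite /s /index_iota subn0; elim: (iota 0 N) => [|m l IH]; first by rewrite !big_nil.
  by rewrite big_cons IH volE /=; case: (g m) => [c|] /=; rewrite ?big_cons ?add0r.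
have psV N : \sum_(0 <= m < N) vol (A m) (B m) <= V.
  rewrite psum leNgt; apply/negP => h; apply: hno; exists (s N); split => //.
  - exact: (pmap_uniq gK (iota_uniq _ _)).
  - by move=> c /snew /asboolP[].
  - by move=> c c' p /snew nc /snew nc'; apply: disj.
apply: (@le_trans _ _ (\sum_(0 <= m <oo) (vol (A m) (B m))%:E)%E).
  apply: ereal_inf_lbound; exists A, B; split => //.
    move=> m i; rewrite /A /B; case: (g m) => // c.
    by rewrite ler_pM2r ?invr_gt0 ?exprn_gt0 // lerDl.
  move=> p /hP hk.
  have [k Pk kmin] : exists2 k, P k (dyadic k p) & forall k', (k' < k)%N -> ~ P k' (dyadic k' p).
    have hk' : exists k, `[< P k (dyadic k p) >] by case: hk => k ?; exists k; apply/asboolP.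
    exists (ex_minn hk'); first by case: ex_minnP => k /asboolP.
    by case: ex_minnP => k _ hmin k' kk' /asboolP /hmin; rewrite leqNgt kk'.
  exists (pickle ((k, dyadic k p) : T)) => //.
  have gE : g (pickle ((k, dyadic k p) : T)) = Some (k, dyadic k p).
    rewrite /g pickleK_inv; case: ifP => // /asboolP; case; split => //=.
    by exists p.
  move=> i; rewrite /A /B gE /=.
  have := (dyadicP k p _).1 erefl i; rewrite intrD => /andP[h1 h2].
  have k0 : 0 < 2 ^+ k :> R by rewrite exprn_gt0.
  rewrite ler_pdivrMr // ler_pdivlMr // mulrC h1 /=.
  exact: ltW.
apply: lime_le.
  by apply: is_cvg_nneseries => m _ _; rewrite lee_fin.
by apply: nearW => N; rewrite sumEFin lee_fin.
Qed.

(** An interval of length [l] contains more than [l / ka - 2] grid points, and [l / ka >= 4] absorbs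
    the lost end points into a factor 2. *)
Lemma card_grid_ge (R : realType) (M : nat) (al l ka : R) : 0 < ka -> 4 * ka <= l ->
  0 <= al -> al + l <= ka * M%:R ->
  l / (2 * ka) <= #|[set j : 'I_M | al <= ka * j%:R < al + l]%SET|%:R.
Proof.
move=> ka0 kl al0 alM.
pose j0 := (Num.trunc (al / ka)).+1; pose m := (Num.trunc (l / ka)).-1.
have q0 : 0 <= al / ka by rewrite divr_ge0 // ltW.
have l4 : 4 <= l / ka by rewrite ler_pdivlMr.
have hj1 : al < ka * j0%:R by rewrite mulrC -ltr_pdivrMr // truncnS_gt.
have hj2 : ka * j0%:R <= al + ka.
  have : (Num.trunc (al / ka))%:R <= al / ka by rewrite truncn_le.
  by rewrite ler_pdivlMr // /j0 -natr1; lra.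
have tr4 : (4 <= Num.trunc (l / ka))%N by rewrite truncn_ge_nat //; lra.
have mE : m.+1%:R <= l / ka.
  by rewrite /m prednK ?truncn_le; [lra|exact: leq_trans tr4].
have mE2 : l / ka < m.+2%:R.
  by rewrite /m prednK; [exact: truncnS_gt|exact: leq_trans tr4].
rewrite ler_pdivlMr // in mE.
have hb (i : 'I_m) : ka * (j0 + i)%:R < al + l.
  have : i.+1%:R <= m%:R :> R by rewrite ler_nat.
  rewrite natrD -natr1 => hi; rewrite -natr1 in mE; nra.
have hM (i : 'I_m) : (j0 + i < M)%N.
  rewrite -(ltr_nat R) -(ltr_pM2l ka0); exact: lt_le_trans (hb i) alM.
pose f (i : 'I_m) : 'I_M := Ordinal (hM i).
have finj : injective f.
  by move=> i i' /(congr1 val) /= /addnI; apply: val_inj.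
set S : {set 'I_M} := [set j | _]%SET.
have : (m <= #|S|)%N.
  rewrite -[leqLHS]card_ord -(card_imset _ finj); apply: subset_leq_card.
  apply/fintype.subsetP => _ /imsetP[i _ ->]; rewrite /S inE /= hb andbT natrD.
  have : 0 <= i%:R :> R by rewrite ler0n.
  by move=> i0; nra.
rewrite -(ler_nat R); apply: le_trans.
have -> : l / (2 * ka) = l / ka / 2 by field; rewrite gt_eqF.
by move: mE2; rewrite -natr1 -natr1; lra.
Qed.

Lemma count_at_most_one (T : eqType) (s : seq T) (b : pred T) : uniq s ->
  (forall c c', c \in s -> c' \in s -> b c -> b c' -> c = c') ->
  (count b s <= has b s)%N.
Proof.
move=> us h; rewrite has_count -size_filter.
have := filter_uniq b us; have : forall c, c \in [seq x <- s | b x] -> b c /\ c \in s.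
  by move=> c; rewrite mem_filter => /andP.
case: [seq x <- s | b x] => [|c [|c' l]] // hf /= /andP[/negP cl _]; exfalso; apply: cl.
have [|bc cs] := hf c; first by rewrite inE eqxx.
have [|bc' cs'] := hf c'; first by rewrite !inE eqxx orbT.
by rewrite (h _ _ cs cs' bc bc') mem_head.
Qed.

Lemma card_family_prod (aT rT : finType) (F : aT -> pred rT) :
  #|family F| = (\prod_(i : aT) #|F i|)%N.
Proof. by rewrite card_family foldrE big_image. Qed.

(* A random grid point [v] of the cube of half-side [4 t] around [y0]: for every fixed
   ratio in [1/2, 1] the point dividing [y0, v] in that ratio lies in the cells
   with probability at least [theta], so some [v], not too close to [y0], sees
   many of the [L] equidistant ratios. *)
Lemma segment_through_cells (R : realType) (n : nat) (y0 : Rn R n) (t : R) (i0 : 'I_n)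
    (s : seq (nat * {ffun 'I_n -> int})) (theta : R) (L : nat) :
  0 < t -> 0 < theta -> (0 < L)%N -> uniq s ->
  (forall c c' (p : Rn R n), c \in s -> c' \in s ->
      dyadic c.1 p = c.2 -> dyadic c'.1 p = c'.2 -> c = c') ->
  (forall c i, c \in s -> y0 i - 2 * t <= (c.2 i)%:~R / 2 ^+ c.1 /\
     ((c.2 i)%:~R + 1) / 2 ^+ c.1 <= y0 i + 2 * t) ->
  theta * (16 * t) ^+ n <= \sum_(c <- s) (2 ^- c.1) ^+ n ->
  exists w : Rn R n, exists A : {set 'I_L}, [/\ theta * t <= `|w i0|,
    forall i, `|w i| <= 4 * t,
    forall j, j \in A -> exists2 c, c \in s &
      dyadic c.1 (fun i => y0 i + (1 / 2 + j%:R / (2 * L%:R)) * w i) = c.2 &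
    theta / 2 * L%:R <= #|A|%:R].
Proof.
move=> t0 th0 L0 us disj hs hth.
pose kmax := \max_(c <- s) c.1.
(* The first bound makes the mesh [h] at most a quarter of the smallest cell side, as [card_grid_ge]
   requires; the second makes the slab [Bs] contain fewer than [theta / 2 * M] grid values. *)
pose M := (Num.trunc (Num.max (32 * t * 2 ^+ kmax) (4 / theta))).+1.
have Mmax : Num.max (32 * t * 2 ^+ kmax) (4 / theta) < M%:R by exact: truncnS_gt.
have [M1 M2] : 32 * t * 2 ^+ kmax < M%:R /\ 4 / theta < M%:R.
  by move: Mmax; rewrite gt_max => /andP.
have M0 : 0 < M%:R :> R by rewrite ltr0n.
rewrite ltr_pdivrMr // in M2.
have L0' : 0 < L%:R :> R by rewrite ltr0n.
pose h : R := 8 * t / M%:R.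
have h0 : 0 < h by rewrite divr_gt0 // mulr_gt0.
have hM : h * M%:R = 8 * t by rewrite /h divfK // gt_eqF.
pose w (g : {ffun 'I_n -> 'I_M}) : Rn R n := fun i => h * (g i)%:R - 4 * t.
pose rat (j : 'I_L) : R := 1 / 2 + j%:R / (2 * L%:R).
have ratb j : 1 / 2 <= rat j <= 1.
  have a0 : 0 <= j%:R / (2 * L%:R) :> R by rewrite divr_ge0 ?mulr_ge0 ?ler0n.
  have a1 : j%:R / (2 * L%:R) <= 1 / 2 :> R.
    rewrite ler_pdivrMr ?mulr_gt0 //.
    have : j%:R <= L%:R :> R by rewrite ler_nat ltnW.
    lra.
  by rewrite /rat; apply/andP; split; lra.
pose pt g j : Rn R n := fun i => y0 i + rat j * w g i.
pose G c j := [set g | dyadic c.1 (pt g j) == c.2]%SET.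
(* A cell of side [l] pulls back to a box of side [l / rat j >= l]. The ratio is at least 1/2, so a
   cell within [2 * t] of [y0] pulls back into the cube of half-side [4 * t]. Each coordinate thus
   keeps a proportion [l / (8 * t)] of the grid, halved by [card_grid_ge]: the origin of
   [16 * t]. *)
have hG c j : c \in s -> M%:R ^+ n * ((2 ^- c.1) / (16 * t)) ^+ n <= #|G c j|%:R.
  move=> cs; have /andP[r1 r2] := ratb j.
  pose l : R := 2 ^- c.1.
  have k0 : 0 < 2 ^+ c.1 :> R by rewrite exprn_gt0.
  have l0 : 0 < l by rewrite invr_gt0.
  have lk : 2 ^+ c.1 * l = 1 by rewrite divff // gt_eqF.
  pose al i : R := (c.2 i)%:~R * l - y0 i + 4 * t * rat j.
  pose F i := [set m : 'I_M | al i <= rat j * h * m%:R < al i + l]%SET.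
  have ll : 32 * t <= l * M%:R.
    have ck : 2 ^+ c.1 <= 2 ^+ kmax :> R.
      by rewrite ler_eXn2l ?ltr1n //; exact: leq_bigmax_seq.
    rewrite -(ler_pM2l k0) [leRHS]mulrA lk mul1r.
    have := ler_wpM2l (ltW t0) ck; lra.
  have hl : 4 * h <= l.
    by rewrite -(ler_pM2r M0) -mulrA hM; lra.
  have hF i : l * M%:R / (16 * t) <= #|F i|%:R.
    have [c1 c2] := hs _ i cs.
    rewrite mulrDl mul1r -/l in c2; rewrite -/l in c1.
    have rh : 0 < rat j * h by apply: mulr_gt0 => //; lra.
    apply: (@le_trans _ _ (l / (2 * (rat j * h)))).
      have rh2 : 0 < 2 * (rat j * h) by lra.
      have t16 : 0 < 16 * t by lra.
      rewrite ler_pdivlMr // mulrAC ler_pdivrMr //.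
      have -> : l * M%:R * (2 * (rat j * h)) = l * 2 * rat j * (h * M%:R) by ring.
      rewrite hM; have : 0 < l * t by rewrite mulr_gt0.
      by move=> lt; move: lt r2; clear; nra.
    apply: card_grid_ge.
    - exact: rh.
    - nra.
    - rewrite /al; nra.
    - rewrite -mulrA hM /al; nra.
  have sub : (#|family (fun i => mem (F i))| <= #|G c j|)%N.
    apply: subset_leq_card; apply/fintype.subsetP => g /familyP hg.
    rewrite inE; apply/eqP/dyadicP => i.
    have := hg i; rewrite inE intrD => /andP[g1 g2].
    have e : 2 ^+ c.1 * pt g j i = 2 ^+ c.1 * (rat j * h * (g i)%:R - al i) + (c.2 i)%:~R.
      transitivity (2 ^+ c.1 * (rat j * h * (g i)%:R - al i) + 2 ^+ c.1 * l * (c.2 i)%:~R).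
        by rewrite /pt /w /al; ring.
      by rewrite lk mul1r.
    rewrite e; apply/andP; split.
      by rewrite lerDr mulr_ge0 ?subr_ge0 // ltW.
    have : 2 ^+ c.1 * (rat j * h * (g i)%:R - al i) < 2 ^+ c.1 * l.
      by rewrite ltr_pM2l //; lra.
    rewrite lk; lra.
  apply: (@le_trans _ _ (#|family (fun i => mem (F i))|%:R)); last by rewrite ler_nat.
  rewrite card_family_prod natr_prod -exprMn.
  have pc (X : R) : X ^+ n = \prod_(i < n) X by rewrite prodr_const card_ord.
  rewrite pc; apply: ler_prod => i _.
  have e : M%:R * (2 ^- c.1 / (16 * t)) = l * M%:R / (16 * t) by rewrite /l; ring.
  by rewrite e hF andbT divr_ge0 ?mulr_ge0 // ltW.
pose hit g j := has (fun c => dyadic c.1 (pt g j) == c.2) s.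
(* By disjointness a grid point hits at most one cell, so the proportions of the single cells add
   up. *)
have hhit j : theta * M%:R ^+ n <= \sum_g (hit g j)%:R.
  have key g : \sum_(c <- s) (g \in G c j)%:R <= (hit g j)%:R :> R.
    rewrite -natr_sum ler_nat; apply: (leq_trans _ (count_at_most_one us _)).
      rewrite -sum1_count [leqRHS]big_mkcond /=; apply: leq_sum => c _.
      by rewrite inE; case: eqP.
    by move=> c c' cs cs' /eqP h1 /eqP h2; apply: (disj c c' _ cs cs' h1 h2).
  apply: (@le_trans _ _ (\sum_g \sum_(c <- s) (g \in G c j)%:R)); last first.
    by apply: ler_sum => g _; exact: key.
  rewrite exchange_big /=.
  apply: (@le_trans _ _ (\sum_(c <- s) M%:R ^+ n * ((2 ^- c.1) / (16 * t)) ^+ n)).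
    have t16 : 0 < (16 * t) ^+ n by rewrite exprn_gt0 // mulr_gt0.
    rewrite -mulr_sumr (eq_bigr (fun c => (2 ^- c.1) ^+ n / (16 * t) ^+ n)); last first.
      by move=> c _; rewrite expr_div_n.
    rewrite -mulr_suml mulrC ler_pM2l ?exprn_gt0 //.
    by rewrite ler_pdivlMr.
  rewrite big_seq [leRHS]big_seq; apply: ler_sum => c cs.
  apply: (le_trans (hG _ j cs)); rewrite -sum1_card natr_sum big_mkcond.
  by apply: ler_sum => g _; case: ifP.
pose Bs := [set m : 'I_M | `|h * m%:R - 4 * t| < theta * t]%SET.
pose S := [set g : {ffun 'I_n -> 'I_M} | g i0 \in Bs]%SET.
have cBs : #|Bs|%:R <= theta * M%:R / 4 + 1.
  have := @card_set_near_le R M Bs (4 * t / h) (theta * t / h).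
  have -> : 2 * (theta * t / h) + 1 = theta * M%:R / 4 + 1.
    by rewrite /h; field; rewrite !gt_eqF.
  apply; first by rewrite divr_ge0 ?mulr_ge0 // ltW.
  move=> m; rewrite inE => hm.
  have -> : 4 * t / h - m%:R = - (h * m%:R - 4 * t) / h by field; rewrite gt_eqF.
  by rewrite normrM normrN (gtr0_norm (_ : 0 < h^-1)) ?invr_gt0 // ler_pM2r ?invr_gt0 // ltW.
have cS : #|S|%:R * M%:R <= (theta * M%:R / 4 + 1) * M%:R ^+ n.
  pose D (i : 'I_n) : {set 'I_M} := if i == i0 then Bs else [set: 'I_M]%SET.
  have : (#|S| <= #|family (fun i => mem (D i))|)%N.
    apply: subset_leq_card; apply/fintype.subsetP => g; rewrite inE => hg.
    by apply/familyP => i; rewrite /D; case: eqP => [->|_]; [exact: hg|exact: finset.in_setT].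
  rewrite card_family_prod (bigD1 i0) //= {1}/D eqxx -(ler_nat R) natrM => h1.
  apply: (@le_trans _ _ (#|Bs|%:R * (\prod_(i < n | i != i0) M)%:R * M%:R)).
    rewrite ler_pM2r //; apply: (le_trans h1).
    rewrite le_eqVlt; apply/orP; left; apply/eqP; congr (_ * _%:R).
    by apply: eq_bigr => i /negbTE ii; rewrite /D ii cardsT card_ord.
  have -> : M%:R ^+ n = M%:R * (\prod_(i < n | i != i0) M)%:R :> R.
    rewrite -natrM -natrX; congr (_%:R).
    have pc : (M ^ n = \prod_(i < n) M)%N by rewrite prod_nat_const card_ord.
    by rewrite pc (bigD1 i0).
  have Q0 : 0 <= (\prod_(i < n | i != i0) M)%:R :> R by rewrite ler0n.
  have := ler_wpM2r (mulr_ge0 (ltW M0) Q0) cBs; lra.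
have Mn0 : 0 < M%:R ^+ n :> R by rewrite exprn_gt0.
pose A g := [set j | hit g j]%SET.
(* Double counting of the pairs [(g, j)]: if every [g] outside [S] had few hits, [S] would contain a
   proportion [theta / 2] of the grid, against [cS] and the choice of [M]. *)
have [g gS gA] : exists2 g, g \notin S & theta / 2 * L%:R <= #|A g|%:R.
  apply: contrapT => hno.
  have hlow g : g \notin S -> #|A g|%:R <= theta / 2 * L%:R.
    by move=> gS; rewrite leNgt; apply/negP => hlt; apply: hno; exists g => //; exact: ltW.
  have up : \sum_g #|A g|%:R <= #|S|%:R * L%:R + M%:R ^+ n * (theta / 2 * L%:R).
    rewrite (bigID (mem S)) /=; apply: lerD.
      rewrite -sum1_card natr_sum mulr_suml; apply: ler_sum => g _.
      by rewrite mul1r ler_nat -[leqRHS]card_ord max_card.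
    apply: (@le_trans _ _ (\sum_(g : {ffun 'I_n -> 'I_M}) theta / 2 * L%:R)).
      rewrite [leLHS]big_mkcond; apply: ler_sum => g _; case: ifPn => [/hlow //|_].
      by rewrite mulr_ge0 ?divr_ge0 // ltW.
    by rewrite sumr_const card_ffun !card_ord -natrX mulr_natl.
  have low : theta * M%:R ^+ n * L%:R <= \sum_g #|A g|%:R.
    have -> : \sum_g #|A g|%:R = \sum_(j < L) \sum_g (hit g j)%:R :> R.
      rewrite exchange_big /=; apply: eq_bigr => g _.
      rewrite -sum1_card natr_sum big_mkcond; apply: eq_bigr => j _.
      by rewrite inE; case: (hit g j).
    have pc (X : R) : X * L%:R = \sum_(j < L) X.
      by rewrite sumr_const card_ord mulr_natr.
    by rewrite pc; apply: ler_sum => j _; exact: hhit.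
  have SL : theta / 2 * M%:R ^+ n <= #|S|%:R.
    rewrite -(ler_pM2r L0'); lra.
  have := ler_wpM2r (ltW M0) SL.
  have : 4 * M%:R ^+ n < M%:R * theta * M%:R ^+ n by rewrite ltr_pM2r.
  lra.
exists (w g), (A g); split => //.
- by move: gS; rewrite !inE -leNgt.
- move=> i; rewrite /w ler_norml.
  have g0 : 0 <= h * (g i)%:R by rewrite mulr_ge0 ?ler0n // ltW.
  have : h * (g i)%:R <= h * M%:R by rewrite ler_pM2l // ler_nat ltnW.
  by move: g0 hM; clear => ? ? ?; apply/andP; split; lra.
- by move=> j; rewrite inE => /hasP[c cs /eqP e]; exists c.
Qed.

(** * Outer measure of balls *)

Lemma le_leb_outer (R : realType) (n : nat) (A B : set (Rn R n)) : A `<=` B ->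
  (leb_outer A <= leb_outer B)%E.
Proof.
move=> AB; apply: ereal_inf_le_tmp => s [a [b [hab hB ->]]].
by exists a, b; split => //; exact: subset_trans hB.
Qed.

Lemma vol_ge0 (R : realType) (n : nat) (a b : Rn R n) : (forall i, a i <= b i) -> 0 <= vol a b.
Proof. by move=> ab; apply: prodr_ge0 => i _; rewrite subr_ge0. Qed.

Lemma leb_outer_ge0 (R : realType) (n : nat) (A : set (Rn R n)) : (0 <= leb_outer A)%E.
Proof.
apply: le_ereal_inf_tmp => _ [a [b [hab _ ->]]].
by apply: nneseries_ge0 => k _ _; rewrite lee_fin vol_ge0.
Qed.

Lemma ballR_coord (R : realType) (n : nat) (x y : Rn R n) (t : R) i : 0 < t ->
  dist2R x y < t ^+ 2 -> `|x i - y i| < t.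
Proof.
move=> t0 h; rewrite -(ltr_pXn2r (_ : 0 < 2)%N) ?nnegrE //; last exact: ltW.
rewrite real_normK ?num_real //; apply: le_lt_trans h.
by rewrite /dist2R (bigD1 i) //= lerDl; apply: sumr_ge0 => j _; exact: sqr_ge0.
Qed.

Lemma leb_outer_ball_le (R : realType) (n : nat) (x : Rn R n) (t : R) : (0 < n)%N -> 0 < t ->
  (leb_outer (ballR x t) <= ((2 * t) ^+ n)%:E)%E.
Proof.
move=> n0 t0.
pose a (k : nat) : Rn R n := fun i => if k is 0%N then x i - t else 0.
pose b (k : nat) : Rn R n := fun i => if k is 0%N then x i + t else 0.
apply: (@le_trans _ _ (\sum_(0 <= k <oo) (vol (a k) (b k))%:E)%E).
  apply: ereal_inf_lbound; exists a, b; split => //.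
    by move=> [|k] i; rewrite /a /b //; lra.
  move=> y yx; exists 0%N => // i /=.
  have := ballR_coord i t0 yx; rewrite ltr_norml => /andP[? ?].
  by apply/andP; split; lra.
have v0 k : 0 <= vol (a k) (b k).
  by apply: vol_ge0 => i; case: k => [|k]; rewrite /a /b; lra.
apply: lime_le; first by apply: is_cvg_nneseries => m _ _; rewrite lee_fin.
apply: nearW => N; rewrite sumEFin lee_fin.
case: N => [|N]; first by rewrite big_geq // exprn_ge0 // mulr_ge0 // ltW.
rewrite big_nat_recl // big1 => [|k _]; last first.
  by rewrite /vol /a /b prodr_const card_ord subrr expr0n gtn_eqF.
rewrite addr0 /vol /a /b (eq_bigr (fun=> 2 * t)) => [|i _]; last ring.
by rewrite prodr_const card_ord.
Qed.

(** A similarity carries the covers of one ball to covers of the other. Exchanging the balls gives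
    the scaling law of the volume, by which the unit ball enters [d]. *)
Lemma leb_outer_ball_scale (R : realType) (n : nat) (x x' : Rn R n) (t t' : R) :
  0 < t -> 0 < t' ->
  (((t' / t) ^+ n)%:E * leb_outer (ballR x t) <= leb_outer (ballR x' t'))%E.
Proof.
move=> t0 t'0; apply: le_ereal_inf_tmp => _ [a [b [hab hcov ->]]].
pose q := t / t'; have q0 : 0 < q by rewrite divr_gt0.
have qq : t' / t * q = 1 by rewrite /q; field; rewrite !gt_eqF.
pose A k : Rn R n := fun i => x i + q * (a k i - x' i).
pose B k : Rn R n := fun i => x i + q * (b k i - x' i).
have AB k i : A k i <= B k i.
  by rewrite lerD2l ler_pM2l // lerD2r; exact: hab.
have volE k : vol (A k) (B k) = q ^+ n * vol (a k) (b k).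
  have pc (X : R) : X ^+ n = \prod_(i < n) X by rewrite prodr_const card_ord.
  by rewrite pc -big_split; apply: eq_bigr => i _; rewrite /A /B /=; ring.
apply: (@le_trans _ _ (((t' / t) ^+ n)%:E * \sum_(0 <= k <oo) (vol (A k) (B k))%:E)%E).
  apply: lee_wpmul2l; first by rewrite lee_fin exprn_ge0 // divr_ge0 // ltW.
  apply: ereal_inf_lbound; exists A, B; split => // y yx.
  pose y' : Rn R n := fun i => x' i + (y i - x i) / q.
  have : ballR x' t' y'.
    rewrite /ballR /=; have -> : dist2R x' y' = q^-1 ^+ 2 * dist2R x y.
      by rewrite mulr_sumr; apply: eq_bigr => i _; rewrite /y'; ring.
    have -> : t' ^+ 2 = q^-1 ^+ 2 * t ^+ 2 by rewrite /q; field; rewrite !gt_eqF.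
    by rewrite ltr_pM2l // exprn_gt0 // invr_gt0.
  move=> /hcov[k _ hk]; exists k => // i; have /andP[h1 h2] := hk i.
  have e : y i = x i + q * (y' i - x' i) by rewrite /y'; field; rewrite gt_eqF.
  by rewrite e /A /B !lerD2l !ler_pM2l // !lerD2r h1.
rewrite -nneseriesZl; last by move=> k _; rewrite lee_fin vol_ge0.
rewrite le_eqVlt; apply/orP; left; apply/eqP; apply: eq_eseriesr => k _.
by rewrite volE -EFinM mulrA -exprMn qq expr1n mul1r.
Qed.

(** * From cells to lines *)

Lemma sqr_bound (R : realType) (x y : R) : - y <= x -> x <= y -> x ^+ 2 <= y ^+ 2.
Proof. by move=> ? ?; nra. Qed.

Lemma pigeonhole_fiber (T : finType) (A : {set T}) (P : nat) (g : T -> 'I_P) :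
  (0 < #|A|)%N ->
  exists q, (#|A| <= P * #|[set j in A | g j == q]%SET|)%N /\
    (0 < #|[set j in A | g j == q]%SET|)%N.
Proof.
move=> A0; apply: contrapT => hno.
have small q : (P * #|[set j in A | g j == q]%SET| < #|A|)%N.
  rewrite ltnNge; apply/negP => h; apply: hno; exists q; split => //.
  by rewrite lt0n; apply/eqP => e; move: h; rewrite e muln0 leqNgt A0.
have cA : #|A| = (\sum_(q < P) #|[set j in A | g j == q]%SET|)%N.
  rewrite -sum1_card (partition_big g predT) //=; apply: eq_bigr => q _.
  by rewrite -sum1_card; apply: eq_bigl => j; rewrite inE.
have P0 : (0 < P)%N.
  by move/card_gt0P: A0 => [j _]; exact: leq_ltn_trans (ltn_ord (g j)).
have : (P * #|A| < P * #|A|)%N; last by rewrite ltnn.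
rewrite {1}cA big_distrr /=.
apply: (@leq_ltn_trans (\sum_(q < P) (#|A|.-1))%N).
  by apply: leq_sum => q _; have := small q; lia.
by rewrite sum_nat_const card_ord ltn_mul2l P0 /=; lia.
Qed.

Definition cell {R : realType} {n : nat} (k : nat) (J : {ffun 'I_n -> int}) : set (Rn R n) :=
  [set y | forall i, (J i)%:~R / 2 ^+ k <= y i <= ((J i)%:~R + 1) / 2 ^+ k].

(** The cell enlarged by one side length in each real and imaginary direction: room for the discs
    that a complex line carries around its real points in the cell. *)
Definition fat_cell {R : realType} {n : nat} (k : nat) (J : {ffun 'I_n -> int}) : set (Cn R n) :=
  [set z | forall i, ((J i)%:~R - 1) / 2 ^+ k <= z.1 i <= ((J i)%:~R + 2) / 2 ^+ k
        /\ `|z.2 i| <= (2 ^+ k)^-1].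

Lemma fat_cell_exists (R : realType) (n : nat) (f : Cn R n -> R) (x p : Rn R n)
    (t m : R) : uscC f -> dist2R x p < t ^+ 2 -> 0 < t -> f (realpt p) < m ->
  exists k : nat, forall J : {ffun 'I_n -> int}, dyadic k p = J ->
    (forall z, fat_cell k J z -> f z <= m) /\ cell k J `<=` ballR x t.
Proof.
move=> usc xp t0 fp.
have e0 : 0 < m - f (realpt p) by lra.
have [del del0 hdel] := usc (realpt p) _ e0.
pose s := Num.sqrt (dist2R x p).
have xp0 : 0 <= dist2R x p by apply: sumr_ge0 => i _; exact: sqr_ge0.
have sE : s ^+ 2 = dist2R x p by rewrite sqr_sqrtr.
have s0 : 0 <= s by exact: sqrtr_ge0.
have st : s < t by rewrite -(ltr_pXn2r (_ : 0 < 2)%N) ?nnegrE ?sE //; exact: ltW.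
pose g := (t - s) / 2; have g0 : 0 < g by rewrite /g; lra.
pose mu := Num.min (del ^+ 2) (g ^+ 2).
have mu0 : 0 < mu by rewrite lt_min !exprn_gt0.
have [mu1 mu2] : mu <= del ^+ 2 /\ mu <= g ^+ 2 by split; rewrite ge_min lexx ?orbT.
(* With [l = 2 ^- k <= 1], a point of the enlarged cell has squared distance at most
   [n * (4 * l ^+ 2 + l ^+ 2) <= 5 * n * l] from [p]. *)
pose k := (Num.trunc (5 * n%:R / mu)).+1.
have hk : 5 * n%:R / 2 ^+ k < mu.
  have k0 : 0 < 2 ^+ k :> R by rewrite exprn_gt0.
  have : 5 * n%:R / mu < 2 ^+ k.
    apply: (@lt_le_trans _ _ k%:R); first exact: truncnS_gt.
    by rewrite -natrX ler_nat ltnW // ltn_expl.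
  by rewrite !ltr_pdivrMr // [mu * _]mulrC.
pose l : R := (2 ^+ k)^-1.
have l0 : 0 < l by rewrite invr_gt0 exprn_gt0.
have l1 : l <= 1 by rewrite invf_le1 ?exprn_gt0 // exprn_ege1 //; lra.
have lk : 2 ^+ k * l = 1 by rewrite divff // gt_eqF // exprn_gt0.
have close (z : Cn R n) : (forall i, (p i - z.1 i) ^+ 2 <= (2 * l) ^+ 2 /\ z.2 i ^+ 2 <= l ^+ 2) ->
    dist2C (realpt p) z < mu.
  move=> h; apply: le_lt_trans hk.
  have -> : 5 * n%:R / 2 ^+ k = \sum_(i < n) 5 * l.
    by rewrite sumr_const card_ord -mulr_natr /l; ring.
  by apply: ler_sum => i _ /=; have [h1 h2] := h i; nra.
exists k => J /dyadicP hJ.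
have pJ i : (J i)%:~R * l <= p i <= ((J i)%:~R + 1) * l.
  have /andP[h1 h2] := hJ i; rewrite intrD in h2.
  have := ler_wpM2r (ltW l0) h1; have := ler_wpM2r (ltW l0) (ltW h2).
  rewrite (_ : 2 ^+ k * p i * l = p i); last by rewrite mulrAC lk mul1r.
  by move=> -> ->.
split=> [z hz|y hy]; last rewrite /ballR /=.
  apply: ltW; rewrite -[m](subrKC (f (realpt p))); apply: hdel.
  apply: lt_le_trans mu1; apply: close => i; have [/andP[h1 h2] h3] := hz i.
  have /andP[p1 p2] := pJ i; rewrite -/l in h1 h2 h3; split.
    by apply: sqr_bound; lra.
  by rewrite -real_normK ?num_real //; apply: ler_sqr2.
have xpC : dist2C (realpt x) (realpt p) <= (s + g / 2) ^+ 2.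
  rewrite (_ : dist2C _ _ = dist2R x p); last by apply: eq_bigr => i _ /=; ring.
  by rewrite -sE; apply: ler_sqr2; lra.
have pyC : dist2C (realpt p) (realpt y) <= g ^+ 2.
  apply: (le_trans _ mu2); apply/ltW/close => i /=.
  have /andP[h1 h2] := hy i; have /andP[p1 p2] := pJ i; rewrite -/l in h1 h2; split.
    by apply: sqr_bound; lra.
  by rewrite expr0n /= sqr_ge0.
rewrite (_ : dist2R x y = dist2C (realpt x) (realpt y)); last by apply: eq_bigr => i _ /=; ring.
by apply: (dist2C_lt _ _ _ xpC pyC); rewrite /g; lra.
Qed.

Lemma ln_ratio_le (R : realType) (theta pe N : R) : 0 < theta -> 0 < pe ->
  theta ^+ 2 / (4 * pe) <= N ->
  ln (28 * expR 1 / N) <= ln (112 * expR 1 * pe) + 2 * ln theta^-1.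
Proof.
move=> th0 pe0 hN.
have th2 : 0 < theta ^+ 2 by rewrite exprn_gt0.
have N0 : 0 < N by apply: lt_le_trans hN; rewrite divr_gt0 // mulr_gt0.
have ti : 0 < theta^-1 by rewrite invr_gt0.
have ti2 : 0 < theta^-1 ^+ 2 by rewrite exprn_gt0.
have e1 : 0 < expR 1 :> R by exact: expR_gt0.
have E0 : 0 < 112 * expR 1 * pe by rewrite !mulr_gt0.
have e28 : 0 < 28 * expR 1 / N by rewrite divr_gt0 // mulr_gt0.
have Et : 0 < 112 * expR 1 * pe * theta^-1 ^+ 2 by exact: mulr_gt0.
rewrite [2 * _]mulr_natl -lnXn // -lnM ?posrE // ler_ln ?posrE // ler_pdivrMr //.
have -> : 28 * expR 1 = 112 * expR 1 * pe * theta^-1 ^+ 2 * (theta ^+ 2 / (4 * pe)).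
  by field; rewrite !gt_eqF.
by rewrite ler_pM2l.
Qed.

Definition ratio {R : realType} (L j : nat) : R := 1 / 2 + j%:R / (2 * L%:R).

(** The Harnack chain moves the large value from 0 to within [ep] of [c] at the cost of [3 ^+ P];
    then [ep] becomes the unit of length around [c], in which the nodes have spacing
    [1 / (2 * L * ep)]. *)
Lemma grid_remez (R : realType) (u : R * R -> R) (M K C c ep : R) (P L : nat)
    (B : {set 'I_L}) : subharmonicC u -> 0 < K -> 0 < C -> 0 < ep ->
  c ^+ 2 <= (P%:R * ep) ^+ 2 -> (2 * L%:R)^-1 <= ep ->
  (forall (h : R) (z : R * R), 0 <= h <= 1 -> d2 z (h * c, 0) <= (4 * ep) ^+ 2 -> u z <= M) ->
  (forall z : R * R, d2 z (c, 0) <= (8 * ep) ^+ 2 -> u z <= M) ->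
  M - C <= u (0, 0) -> (0 < #|B|)%N ->
  (forall j, j \in B -> `|ratio L j - c| <= ep) ->
  (forall j (z : R * R), j \in B -> d2 z (ratio L j, 0) <= ((2 * L%:R)^-1) ^+ 2 ->
     u z <= M - K) ->
  K <= 3 ^+ P * C * (ln (28 * expR 1 / (#|B|%:R * ((2 * L%:R)^-1 / ep))) / ln (7 / 2)).
Proof.
move=> su K0 C0 ep0 cP Lep hseg hdisc u0 B0 Bc hB.
have L0 : 0 < L%:R :> R.
  rewrite ltr0n; have /card_gt0P[j _] := B0; exact: leq_ltn_trans (ltn_ord j).
have [b hb ub] : exists2 b, d2 b (c, 0) <= ep ^+ 2 & M - 3 ^+ P * C <= u b.
  apply: (harnack_chain (p := (0, 0)) su C0 ep0 _ _ u0).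
  - by move=> h z h01 /=; rewrite add0r subr0 subrr mulr0 addr0; apply: hseg.
  - by rewrite /d2 /= subrr expr0n /= addr0 sub0r sqrrN.
have C40 : 0 < 3 ^+ P * C by rewrite mulr_gt0 // exprn_gt0.
pose o : R * R := (c, 0).
have sv := subharmonicC_affine o ep0 su.
pose eta := (2 * L%:R)^-1 / ep.
have eta0 : 0 < eta by rewrite divr_gt0 // invr_gt0 mulr_gt0.
have etaE : ep * eta = (2 * L%:R)^-1 by rewrite /eta mulrC divfK // gt_eqF.
have eta1 : eta <= 1 by rewrite /eta ler_pdivrMr // mul1r.
pose s0 := (1 / 2 - c) / ep.
have polE (j : 'I_L) : ep * (s0 + eta * j%:R) = ratio L j - c.
  rewrite mulrDr /s0 [ep * (_ / _)]mulrC divfK ?gt_eqF // mulrA etaE /ratio; ring.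
apply: (@discrete_remez R _ M K (3 ^+ P * C) s0 eta L B ((b.1 - c) / ep, b.2 / ep) sv) => //.
- by rewrite eta0.
- move=> z hz; apply: hdisc; rewrite /d2 /=.
  rewrite (_ : _ + _ = ep ^+ 2 * (z.1 ^+ 2 + z.2 ^+ 2)); last ring.
  by rewrite exprMn mulrC ler_pM2r // exprn_gt0.
- move=> j jB; rewrite -(ler_pM2l ep0) mulr1 -{1}(gtr0_norm ep0) -normrM polE.
  exact: Bc.
- move=> j z jB hz; apply: (hB j) => //; rewrite -etaE.
  have -> : d2 (o.1 + ep * z.1, o.2 + ep * z.2) (ratio L j, 0) =
      ep ^+ 2 * d2 z (s0 + eta * j%:R, 0).
    have -> : ratio L j = c + ep * (s0 + eta * j%:R) by rewrite polE; ring.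
    by rewrite /d2 /=; ring.
  by rewrite [(ep * eta) ^+ 2]exprMn ler_pM2l // exprn_gt0.
- move: hb; rewrite /d2 /= subr0 !expr_div_n -mulrDl => hb.
  by rewrite ler_pdivrMr ?exprn_gt0 // mul1r.
- suff -> : (o.1 + ep * ((b.1 - c) / ep, b.2 / ep).1,
     o.2 + ep * ((b.1 - c) / ep, b.2 / ep).2) = b by [].
  by rewrite [RHS]surjective_pairing /=; congr pair; field; rewrite gt_eqF.
Qed.

(** The Remez inequality sees nodes in one window only. The ratios span less than [P] windows of
    length [ep], so one window holds at least a share [1 / P] of them. *)
Lemma ratio_cluster (R : realType) (L P : nat) (A : {set 'I_L}) (ep : R) : 0 < ep ->
  (0 < #|A|)%N -> (forall j j', j \in A -> j' \in A -> ratio L j - ratio L j' < P%:R * ep) ->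
  exists (B : {set 'I_L}) (j2 : 'I_L), [/\ j2 \in B, {subset B <= A},
    forall j, j \in B -> `|ratio L j - ratio L j2| <= ep & (#|A| <= P * #|B|)%N].
Proof.
move=> ep0 A0 diam.
have [j1 j1A jmin] : exists2 j1, j1 \in A & forall j, j \in A -> (j1 <= j)%N.
  have /card_gt0P[j jA] := A0.
  by have [j1 ? ?] := arg_minnP (fun j : 'I_L => j : nat) jA; exists j1.
have L0 : 0 < L%:R :> R by rewrite ltr0n; exact: leq_ltn_trans (ltn_ord j1).
have ratmono j : j \in A -> 0 <= (ratio L j - ratio L j1) / ep.
  move=> jA; apply: divr_ge0; last exact: ltW.
  rewrite subr_ge0 lerD2l ler_pM2r ?ler_nat ?jmin //.
  by rewrite invr_gt0 mulr_gt0.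
have gP j : j \in A -> (Num.trunc ((ratio L j - ratio L j1) / ep) < P)%N.
  move=> jA; rewrite truncn_lt_nat; last exact: ratmono.
  by rewrite ltr_pdivrMr // diam.
have P0 : (0 < P)%N by exact: leq_ltn_trans (gP _ j1A).
rewrite -(prednK P0) in gP diam *.
pose g (j : 'I_L) : 'I_P.-1.+1 := inord (Num.trunc ((ratio L j - ratio L j1) / ep)).
have [q [cq q0]] := pigeonhole_fiber g A0.
set B : {set 'I_L} := [set j in A | _]%SET in cq q0.
have BA j : j \in B -> j \in A by rewrite inE => /andP[].
have /card_gt0P[j2 j2B] := q0.
exists B, j2; split => //.
have tr (j' : 'I_L) : j' \in B -> q%:R <= (ratio L j' - ratio L j1) / ep < q.+1%:R.
  move=> j'B; have j'A := BA _ j'B.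
  move: j'B; rewrite inE => /andP[_ /eqP /(congr1 val)] /=; rewrite inordK ?gP // => e'.
  by rewrite -e' truncn_itv // ratmono.
move=> j jB; have /andP[h1 h2] := tr _ jB; have /andP[h3 h4] := tr _ j2B.
rewrite -!natr1 in h2 h4.
rewrite ler_pdivlMr // in h1; rewrite ler_pdivlMr // in h3.
rewrite ltr_pdivrMr // in h2; rewrite ltr_pdivrMr // in h4.
by rewrite ler_norml; apply/andP; split; lra.
Qed.

Lemma fat_cell_disc (R : realType) (n k : nat) (J : {ffun 'I_n -> int}) (y w : Rn R n)
    (r d b : R) (z : R * R) :
  dyadic k (fun i => y i + r * w i) = J -> 0 < d -> (forall i, `|w i| <= b) ->
  d * b <= (2 ^+ k)^-1 -> d2 z (r, 0) <= d ^+ 2 ->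
  fat_cell k J (cline (realpt y) (realpt w) z).
Proof.
move=> /dyadicP hJ d0 wb db hz i; have := hJ i; rewrite intrD => /andP[p1 p2].
have k0 : 0 < 2 ^+ k :> R by rewrite exprn_gt0.
pose l : R := (2 ^+ k)^-1; have l0 : 0 < l by rewrite invr_gt0.
have lk : 2 ^+ k * l = 1 by rewrite divff // gt_eqF.
have := ler_wpM2r (ltW l0) p1; have := ler_wpM2r (ltW l0) (ltW p2).
rewrite (mulrAC (2 ^+ k)) lk mul1r => q2 q1.
have small (s : R) : s ^+ 2 <= d ^+ 2 -> `|s * w i| <= l.
  move=> hs; rewrite normrM; apply: le_trans db; apply: ler_pM => //.
  rewrite -(ler_pXn2r (_ : 0 < 2)%N) ?nnegrE //; last exact: ltW.
  by rewrite real_normK ?num_real.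
rewrite /d2 /= subr0 in hz.
have s1 : `|(z.1 - r) * w i| <= l by apply: small; apply: le_trans hz; rewrite lerDl sqr_ge0.
have s2 : `|z.2 * w i| <= l by apply: small; apply: le_trans hz; rewrite lerDr sqr_ge0.
split; last by rewrite /= mulr0 !add0r.
clear -s1 q1 q2; move: s1; rewrite ler_norml /= -/l => /andP[? ?].
by apply/andP; split; lra.
Qed.

Lemma dist2C_real_cline (R : realType) (n : nat) (x y w : Rn R n) (r : R) :
  dist2C (realpt x) (cline (realpt y) (realpt w) (r, 0)) = dist2R x (fun i => y i + r * w i).
Proof. by apply: eq_bigr => i _ /=; ring. Qed.

(** In the parameter of the line, [ep = e * t / W] represents the length [e * t]. Two points of the
    ball are at distance less than [2 * t], hence less than [P] such lengths, so both the chain from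
    [y0] and the clustering cost a factor depending on [a] only. *)
Lemma line_remez (R : realType) (n : nat) (f : Cn R n -> R) (x y0 w : Rn R n)
    (a t e M K C W theta : R) (P L : nat) (A : {set 'I_L}) :
  psh f -> 0 < K -> 0 < C -> 0 < t -> 0 < e -> 8 * e = a - 1 -> 2 < P%:R * e ->
  0 < theta -> 0 < W -> norm2C (realpt w) = W ^+ 2 -> theta * t <= W ->
  W <= 2 * L%:R * (e * t) -> (0 < #|A|)%N -> theta / 2 * L%:R <= #|A|%:R ->
  (forall z, dist2C (realpt x) z < (a * t) ^+ 2 -> f z <= M) ->
  dist2R x y0 < t ^+ 2 -> M - C <= f (realpt y0) ->
  (forall j, j \in A -> dist2R x (fun i => y0 i + ratio L j * w i) < t ^+ 2) ->
  (forall j z, j \in A -> d2 z (ratio L j, 0) <= ((2 * L%:R)^-1) ^+ 2 ->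
     f (cline (realpt y0) (realpt w) z) <= M - K) ->
  K <= 3 ^+ P * C / ln (7 / 2) * (ln (112 * expR 1 * (P%:R * e)) + 2 * ln theta^-1).
Proof.
move=> pf K0 C0 t0 e0 ea Pe th0 W0 WE Wge Wle A0 cA hM xy0 fy0 Aball Adisc.
pose u := fun b => f (cline (realpt y0) (realpt w) b).
have su : subharmonicC u by exact: pf.2.
pose ep := e * t / W; have et0 : 0 < e * t by rewrite mulr_gt0.
have ep0 : 0 < ep by rewrite divr_gt0.
have epW (k : R) : (k * ep) ^+ 2 * W ^+ 2 = (k * (e * t)) ^+ 2.
  by rewrite /ep; field; rewrite gt_eqF.
have eW : ep * W = e * t by rewrite /ep divfK // gt_eqF.
clearbody ep.
have L0 : 0 < L%:R :> R.
  by rewrite ltr0n; have /card_gt0P[j _] := A0; exact: leq_ltn_trans (ltn_ord j).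
have L20 : 0 < 2 * L%:R :> R by rewrite mulr_gt0.
have epE : (2 * L%:R)^-1 <= ep.
  by rewrite -(ler_pM2r W0) eW ler_pdivrMl.
have at8 : a * t = t + 8 * (e * t) by rewrite mulrA ea; ring.
have P2 : 2 * t < P%:R * (e * t) by rewrite mulrA ltr_pM2r.
have near (r : R) (b : R * R) (k : R) : 0 < k -> t + k * (e * t) <= a * t ->
    dist2R x (fun i => y0 i + r * w i) < t ^+ 2 ->
    d2 b (r, 0) <= (k * ep) ^+ 2 -> u b <= M.
  move=> k0 ka hr hb; apply: hM.
  have kt : 0 < k * (e * t) by rewrite mulr_gt0.
  rewrite -dist2C_real_cline in hr.
  apply: (lt_le_trans (dist2C_lt_le t0 kt hr (c := cline (realpt y0) (realpt w) b) _)).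
    rewrite dist2C_cline WE -epW ler_pM2r ?exprn_gt0 //.
    by move: hb; rewrite /d2 /= -sqrrN opprB -(sqrrN (b.2 - 0)) opprB.
  by apply: ler_sqr2 => //; rewrite addr_ge0 // ltW.
have diam (r r' : R) : dist2R x (fun i => y0 i + r * w i) < t ^+ 2 ->
    dist2R x (fun i => y0 i + r' * w i) < t ^+ 2 -> (r - r') ^+ 2 < (P%:R * ep) ^+ 2.
  rewrite -!dist2C_real_cline => h1 h2.
  rewrite -(ltr_pM2r (exprn_gt0 2 W0)) epW.
  have -> : (r - r') ^+ 2 * W ^+ 2 = dist2C (cline (realpt y0) (realpt w) (r, 0))
      (cline (realpt y0) (realpt w) (r', 0)).
    by rewrite dist2C_cline WE /d2 /= subrr expr0n /= addr0.
  apply: (@lt_trans _ _ ((t + t) ^+ 2)).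
    by apply: (dist2C_lt_le t0 t0 (b := realpt x)); [rewrite dist2CC|exact: ltW].
  by clear -t0 P2; apply: ltr_sqr2; lra.
have Pep0 : 0 < P%:R * ep.
  by rewrite -(ltr_pM2r W0) mul0r -mulrA eW; apply: lt_trans P2; rewrite mulr_gt0.
have [B [j2 [j2B BA Bnear cB]]] : exists (B : {set 'I_L}) (j2 : 'I_L),
    [/\ j2 \in B, {subset B <= A},
    forall j, j \in B -> `|ratio L j - ratio L j2| <= ep & (#|A| <= P * #|B|)%N].
  apply: ratio_cluster => // j j' jA j'A.
  have := diam _ _ (Aball _ jA) (Aball _ j'A).
  rewrite -real_normK ?num_real // ltr_pXn2r ?nnegrE //; last exact: ltW.
  by apply: le_lt_trans; exact: ler_norm.
set c := ratio L j2 in Bnear.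
have y0E : (fun i => y0 i + 0 * w i) = y0 by apply/funext => i; rewrite mul0r addr0.
have xc : dist2R x (fun i => y0 i + c * w i) < t ^+ 2 := Aball _ (BA _ j2B).
have B0 : (0 < #|B|)%N by apply/card_gt0P; exists j2.
have KB : K <= 3 ^+ P * C * (ln (28 * expR 1 / (#|B|%:R * ((2 * L%:R)^-1 / ep))) / ln (7 / 2)).
  apply: (@grid_remez R u M K C c ep P L B su K0 C0 ep0 _ epE) => //.
  - apply: ltW; rewrite -[c]subr0; apply: diam => //; by rewrite y0E.
  - move=> h z h01; apply: near => //.
      by rewrite at8 lerD2l ler_pM2r // ler_nat.
    rewrite -dist2C_real_cline.
    have -> : cline (realpt y0) (realpt w) (h * c, 0) =
        cline (realpt y0) (subC (cline (realpt y0) (realpt w) (c, 0)) (realpt y0)) (h, 0).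
      by congr pair; apply/funext => i /=; ring.
    apply: dist2C_convex => //; last by rewrite dist2C_real_cline.
    by rewrite -(cline0 (realpt y0) (realpt w)) dist2C_real_cline y0E.
  - move=> z; apply: near => //.
    by rewrite at8.
  - by rewrite /u cline0.
  - by move=> j z /BA jA; apply: Adisc.
(* The number [L] cancels: at least [theta * L / (2 * P)] nodes have spacing [1 / (2 * L * ep)]. One
   factor [theta] is the density of the nodes; the other comes from [ep <= e / theta], as the
   direction [w] can be as short as [theta * t]. *)
have Nlow : theta ^+ 2 / (4 * (P%:R * e)) <= #|B|%:R * ((2 * L%:R)^-1 / ep).
  have Pe0 : 0 < P%:R * e by apply: lt_trans Pe.
  have B0' : 0 < #|B|%:R :> R by rewrite ltr0n.
  have h1 : theta / 2 * L%:R <= P%:R * #|B|%:R.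
    by apply: (le_trans cA); rewrite -natrM ler_nat.
  have h2 : ep * theta <= e.
    by rewrite -(ler_pM2r t0) -mulrA -eW ler_pM2l.
  rewrite ler_pdivrMr; last by rewrite mulr_gt0.
  rewrite -(ler_pM2r ep0) -(ler_pM2r L20).
  have -> : #|B|%:R * ((2 * L%:R)^-1 / ep) * (4 * (P%:R * e)) * ep * (2 * L%:R) =
    4 * (P%:R * #|B|%:R * e) by field; rewrite !gt_eqF.
  have -> : theta ^+ 2 * ep * (2 * L%:R) = 4 * (theta / 2 * L%:R * (ep * theta)) by field.
  rewrite ler_pM2l //; apply: ler_pM => //; apply: mulr_ge0; rewrite ?divr_ge0 //; exact: ltW.
have hln := ln_ratio_le th0 (lt_trans (ltr0Sn R 1) Pe) Nlow.
apply: (le_trans KB); rewrite mulrCA mulrC.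
apply: ler_wpM2l hln; rewrite divr_ge0 ?mulr_ge0 ?exprn_ge0 //; first exact: ltW.
by apply: ln_ge0; rewrite ler_pdivlMr // mul1r ler_nat.
Qed.

Lemma small_set_bound (R : realType) (a C : R) : 1 < a -> 0 < C ->
  exists2 C' : R, 0 < C' & forall n (f : Cn R n -> R) (x y0 : Rn R n) (t M m theta : R)
      (om : set (Rn R n)), (0 < n)%N ->
    psh f -> 0 < t ->
    (forall z, dist2C (realpt x) z < (a * t) ^+ 2 -> f z <= M) ->
    dist2R x y0 < t ^+ 2 -> M - C <= f (realpt y0) ->
    om `<=` ballR x t -> (forall y, om y -> f (realpt y) <= m) ->
    0 < theta <= 1 -> ((theta * (16 * t) ^+ n)%:E < leb_outer om)%E ->
    M - m <= C' * (1 + ln (theta^-1)).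
Proof.
move=> a1 C0; pose e := (a - 1) / 8; have e0 : 0 < e by rewrite /e; lra.
have ea : 8 * e = a - 1 by rewrite /e; field.
pose P := (Num.trunc (2 / e)).+1.
have Pe : 2 < P%:R * e by rewrite -ltr_pdivrMr // truncnS_gt.
have ex1 : 1 <= expR 1 :> R by have := expR_ge1Dx (1 : R); lra.
pose E0 := 112 * expR 1 * (P%:R * e).
have lE0 : 0 <= ln E0 by rewrite ln_ge0 // /E0; nra.
have l35 : 0 < ln (7 / 2) :> R by rewrite ln_gt0; lra.
pose C5 := 3 ^+ P * C / ln (7 / 2).
have C50 : 0 < C5 by rewrite divr_gt0 // mulr_gt0 // exprn_gt0.
exists (2 * C5 * (ln E0 + 2)); first by apply: mulr_gt0; lra.
move=> n f x y0 t M m theta om n0 pf t0 hM xy0 fy0 omB fom /andP[th0 th1] hom.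
have lth : 0 <= ln theta^-1 by rewrite ln_ge0 // invf_ge1.
have [Mm|Mm] := leP M m.
  by apply: (@le_trans _ _ 0); [rewrite subr_le0|move: lth lE0 C50; clear => *; apply: mulr_ge0; [apply: mulr_ge0|]; lra].
(* Half of the gap is kept as a margin: [f < M - K] holds strictly on [om], so it extends to the
   enlarged cells. *)
pose K := (M - m) / 2; have K0 : 0 < K by rewrite /K; lra.
suff hK : K <= C5 * (ln E0 + 2 * ln theta^-1).
  have MK : M - m = 2 * K by rewrite /K; field.
  have h1 : 0 <= C5 * (ln E0 * ln theta^-1).
    by apply: mulr_ge0; [exact: ltW|exact: mulr_ge0].
  by clear -MK hK h1 C50; lra.
pose good k (J : {ffun 'I_n -> int}) :=
  (forall z, fat_cell k J z -> f z <= M - K) /\ cell k J `<=` ballR x t.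
have goodp p : om p -> exists k, good k (dyadic k p).
  move=> omp; have fp : f (realpt p) < M - K by have := fom _ omp; rewrite /K; lra.
  have [k hk] := fat_cell_exists pf.1 (omB _ omp) t0 fp.
  by exists k; apply: hk.
have [s [us sgood sdisj svol]] := dyadic_cover n0 goodp hom.
pose i0 : 'I_n := Ordinal n0.
have cnear c i : c \in s -> y0 i - 2 * t <= (c.2 i)%:~R / 2 ^+ c.1 /\
     ((c.2 i)%:~R + 1) / 2 ^+ c.1 <= y0 i + 2 * t.
  move=> cs; have [_ h] := sgood c cs.
  have k0 : 0 <= (2 ^+ c.1)^-1 :> R by rewrite invr_ge0 exprn_ge0.
  have : `|x i - (c.2 i)%:~R / 2 ^+ c.1| < t.
    apply: (ballR_coord (y := fun i => (c.2 i)%:~R / 2 ^+ c.1) i t0); apply: h => j.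
    by rewrite lexx /=; apply: ler_wpM2r => //; rewrite lerDl.
  have : `|x i - ((c.2 i)%:~R + 1) / 2 ^+ c.1| < t.
    apply: (ballR_coord (y := fun i => ((c.2 i)%:~R + 1) / 2 ^+ c.1) i t0); apply: h => j.
    by rewrite lexx andbT; apply: ler_wpM2r => //; rewrite lerDl.
  have := ballR_coord i t0 xy0; clear.
  by rewrite !ltr_norml => /andP[? ?] /andP[? ?] /andP[? ?]; split; lra.
pose kmax := \max_(c <- s) c.1.
have n1 : 1 <= n%:R :> R by rewrite ler1n.
(* The first bound fits discs of parameter radius [1 / (2 * L)] into the smallest enlarged cell, as
   [|w i| <= 4 * t]; the second gives [W <= 4 * t * n <= 2 * L * (e * t)], so the node spacing is at
   most [ep]. *)
pose L := (Num.trunc (Num.max (2 * t * 2 ^+ kmax) (2 * n%:R / e))).+1.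
have LM : Num.max (2 * t * 2 ^+ kmax) (2 * n%:R / e) < L%:R by exact: truncnS_gt.
have [L1 L2] : 2 * t * 2 ^+ kmax < L%:R /\ 2 * n%:R / e < L%:R.
  by move: LM; rewrite gt_max => /andP.
have L0 : 0 < L%:R :> R by rewrite ltr0n.
rewrite ltr_pdivrMr // in L2.
have [w [A [w0 w4 hA cA]]] := @segment_through_cells R n y0 t i0 s theta L t0 th0 (ltn0Sn _)
  us sdisj cnear (ltW svol).
pose W2 := norm2C (realpt w).
have W2ge : w i0 ^+ 2 <= W2.
  rewrite /W2 /norm2C (bigD1 i0) //= expr0n /= addr0 lerDl.
  by apply: sumr_ge0 => i _; rewrite addr_ge0 ?sqr_ge0.
have W2le : W2 <= (4 * t * n%:R) ^+ 2.
  have wi i : w i ^+ 2 <= (4 * t) ^+ 2.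
    by rewrite -real_normK ?num_real //; apply: ler_sqr2.
  apply: (@le_trans _ _ (\sum_(i < n) (4 * t) ^+ 2)).
    by apply: ler_sum => i _ /=; rewrite expr0n /= addr0.
  rewrite sumr_const card_ord -[_ *+ n]mulr_natr.
  rewrite (_ : (4 * t * n%:R) ^+ 2 = (4 * t) ^+ 2 * (n%:R * n%:R)); last by ring.
  by apply: ler_wpM2l; [exact: sqr_ge0|rewrite ler_peMr //; apply: le_trans n1].
have tht : 0 < theta * t by rewrite mulr_gt0.
have W20 : 0 < W2.
  apply: lt_le_trans W2ge; rewrite -real_normK ?num_real // exprn_gt0 //.
  exact: lt_le_trans w0.
pose W := Num.sqrt W2; have W0 : 0 < W by rewrite sqrtr_gt0.
have WE : W2 = W ^+ 2 by rewrite sqr_sqrtr // ltW.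
have Wge : theta * t <= W.
  apply: (le_trans w0); rewrite -(ler_pXn2r (_ : 0 < 2)%N) ?nnegrE //; last exact: ltW.
  by rewrite real_normK ?num_real // -WE.
have t4 : 0 <= 4 * t * n%:R by rewrite !mulr_ge0 // ltW.
have Wle : W <= 4 * t * n%:R.
  by rewrite -(ler_pXn2r (_ : 0 < 2)%N) ?nnegrE -?WE // ltW.
have A0 : (0 < #|A|)%N.
  by rewrite -(ltr_nat R); apply: lt_le_trans cA; rewrite mulr_gt0 // divr_gt0.
apply: (line_remez pf K0 C0 t0 e0 ea Pe th0 W0 WE Wge _ A0 cA hM xy0 fy0).
- apply: (le_trans Wle); rewrite mulrA (_ : 2 * L%:R * e = 2 * (L%:R * e)); last by ring.
  rewrite (_ : 4 * t * n%:R = 2 * (2 * n%:R) * t); last by ring.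
  by rewrite ler_pM2r // ler_pM2l // ltW.
- move=> j jA; have [c cs /dyadicP hc] := hA j jA; have [_ h] := sgood c cs.
  apply: h => i; have := hc i; rewrite intrD => /andP[p1 p2].
  have k0 : 0 < 2 ^+ c.1 :> R by rewrite exprn_gt0.
  by rewrite ler_pdivrMr // ler_pdivlMr // mulrC p1 /= mulrC ltW // mulrC.
- move=> j z jA hz; have [c cs hc] := hA j jA; have [h _] := sgood c cs.
  have d0 : 0 < (2 * L%:R)^-1 :> R by rewrite invr_gt0 mulr_gt0.
  apply: h; apply: (fat_cell_disc hc d0 w4 _ hz).
  rewrite ler_pdivrMl ?mulr_gt0 // ler_pdivlMr ?exprn_gt0 //.
  have ck : 2 ^+ c.1 <= 2 ^+ kmax :> R.
    by rewrite ler_eXn2l ?ltr1n //; exact: leq_bigmax_seq.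
  have := ler_wpM2l (ltW t0) ck; clear -L1; lra.
Qed.

(** * The theorem *)

Definition unit_ball_vol (R : realType) (n : nat) : R :=
  fine (leb_outer (ballR (fun=> 0) 1 : set (Rn R n))).

(* The summand [expR 1] keeps the logarithm at least 1, so that additive constants are
   absorbed into [c]. *)
Lemma local_inequality (R : realType) (a r : R) : 1 < a -> 1 < r ->
  exists2 c : R, 0 < c & forall n (f : Cn R n -> R) (x : Rn R n) (t : R)
      (om : set (Rn R n)), (0 < n)%N -> classF r f -> 0 < t ->
    realpt @` ballR x t `<=` ballC (realpt x) (a * t) ->
    ballC (realpt x) (a * t) `<=` ballC (realpt (fun=> 0)) 1 ->
    om `<=` ballR x t -> (0 < leb_outer om)%E ->
    (ereal_sup [set (f (realpt y))%:E | y in ballR x t] <=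
     (c * ln ((expR 1 + 2 * 16 ^+ n / unit_ball_vol R n) *
        fine (leb_outer (ballR x t)) / fine (leb_outer om)))%:E
     + ereal_sup [set (f (realpt y))%:E | y in om])%E.
Proof.
move=> a1 r1; have [C1 C10 H1] := doubling a1 r1.
have [C2 C20 H2] := real_point a1 C10.
have [C3 C30 H3] := small_set_bound a1 C20.
exists (2 * C3); first by rewrite mulr_gt0.
move=> n f x t om n0 Ff t0 BB hsub omB om0.
have at0 : 0 < a * t by rewrite mulr_gt0 //; lra.
have hsub' z : dist2C (realpt x) z < (a * t) ^+ 2 -> dist2C orig z < 1.
  by move=> hz; have := hsub z hz; rewrite /ballC /= expr1n.
have f0 z : dist2C (realpt x) z < (a * t) ^+ 2 -> f z <= 0.
  move=> /hsub' hz; apply: (classF_le0 Ff); apply: (lt_trans hz).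
  by rewrite -[ltLHS](expr1n _ 2); apply: ltr_sqr2; lra.
pose S := [set f z | z in ballC (realpt x) (a * t)].
have Sx : S (f (realpt x)).
  exists (realpt x) => //; rewrite /ballC /= /dist2C big1 ?exprn_gt0 // => i _.
  by rewrite /= !subrr expr0n /= addr0.
have Ssup : has_sup S.
  by split; [exists (f (realpt x))|exists 0 => _ [z hz <-]; exact: f0].
pose M := sup S.
have hM z : dist2C (realpt x) z < (a * t) ^+ 2 -> f z <= M.
  by move=> hz; apply: (sup_upper_bound Ssup); exists z.
have M0 : M <= 0 by apply: ge_sup; [exists (f (realpt x))|move=> _ [z hz <-]; exact: f0].
have [w hw fw] : exists2 w, dist2C (realpt x) w < (a * t) ^+ 2 & M - 1 <= f w.
  have [_ [w hw <-] h] := sup_adherent ltr01 Ssup.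
  by exists w => //; exact: ltW.
have [z1 xz1 fz1] : exists2 z, dist2C (realpt x) z <= (t / 4) ^+ 2 & M - C1 <= f z.
  by apply: (H1 n f (realpt x) t M n0 Ff t0 hsub' hM M0); exists w.
have [y0 xy0 fy0] := H2 n f x t M z1 Ff.1 t0 hM xz1 fz1.
have fB y : ballR x t y -> f (realpt y) <= M.
  by move=> hy; apply: hM; apply: BB; exists y.
(* A point of [om] keeps the supremum over [om] away from minus infinity, so that it is a real
   number [m]. *)
have [y1 omy1] : exists y, om y.
  apply: contrapT => hno; have om_0 : om = set0.
    by apply/seteqP; split => // y hy; exfalso; apply: hno; exists y.
  move: om0; rewrite ltNge; apply/negP/negPn.
  apply: (@le_trans _ _ (\sum_(0 <= k <oo) (vol (fun=> 0 : R) (fun=> 0 : R) : R)%:E)%E).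
    apply: ereal_inf_lbound; exists (fun _ (_ : 'I_n) => 0), (fun _ (_ : 'I_n) => 0).
    by split => //; rewrite om_0.
  rewrite eseries0 // => k _ _.
  by rewrite /vol prodr_const card_ord subrr expr0n gtn_eqF.
set E := ereal_sup [set (f (realpt y))%:E | y in om].
have EM : (E <= M%:E)%E.
  by apply: ge_ereal_sup => _ [y omy <-]; rewrite lee_fin; exact/fB/omB.
have Ey1 : ((f (realpt y1))%:E <= E)%E by apply: ereal_sup_ubound; exists y1.
have Efin : E \is a fin_num.
  rewrite fin_numE; apply/andP; split; apply/eqP => e; first by move: Ey1; rewrite e.
  by move: EM; rewrite e.
pose m := fine E; have mE : m%:E = E by rewrite /m fineK.
have hm y : om y -> f (realpt y) <= m.
  by move=> omy; rewrite -lee_fin mE; apply: ereal_sup_ubound; exists y.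
have ballfin (x' : Rn R n) (t' : R) : 0 < t' -> leb_outer (ballR x' t') \is a fin_num.
  move=> t'0; rewrite ge0_fin_numE ?leb_outer_ge0 //.
  by apply: (le_lt_trans (leb_outer_ball_le x' n0 t'0)); rewrite ltry.
have omB' : (leb_outer om <= leb_outer (ballR x t))%E by exact: le_leb_outer.
have omfin : leb_outer om \is a fin_num.
  rewrite ge0_fin_numE ?leb_outer_ge0 //; apply: (le_lt_trans omB').
  by rewrite -ge0_fin_numE ?leb_outer_ge0 // ballfin.
pose lo := fine (leb_outer om); have loE : leb_outer om = lo%:E by rewrite /lo fineK.
pose lB := fine (leb_outer (ballR x t)).
have lBE : leb_outer (ballR x t) = lB%:E by rewrite /lB fineK // ballfin.
pose bn := unit_ball_vol R n.
have bnE : leb_outer (ballR (fun=> 0) 1 : set (Rn R n)) = bn%:E.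
  by rewrite /bn /unit_ball_vol fineK // ballfin.
have lo0 : 0 < lo by rewrite -lte_fin -loE.
have loB : lo <= lB by rewrite -lee_fin -loE -lBE.
have tn0 : 0 < t ^+ n by rewrite exprn_gt0.
have h1 : t ^+ n * bn <= lB.
  have := leb_outer_ball_scale (fun=> 0) x ltr01 t0.
  by rewrite divr1 bnE lBE -EFinM lee_fin.
have h2 : (1 / t) ^+ n * lB <= bn.
  have := leb_outer_ball_scale x (fun=> 0) t0 ltr01.
  by rewrite bnE lBE -EFinM lee_fin.
have bn0 : 0 < bn.
  by apply: lt_le_trans h2; rewrite mulr_gt0 ?exprn_gt0 ?divr_gt0 //; lra.
have lo2 : lo <= (2 * t) ^+ n.
  by rewrite -lee_fin -loE; apply: (le_trans omB'); exact: leb_outer_ball_le.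
have t16 : 0 < (16 * t) ^+ n by rewrite exprn_gt0 // mulr_gt0.
(* Half of the volume of [om] leaves the strict inequality that the selection of cells asks for. *)
pose theta := lo / 2 / (16 * t) ^+ n.
have th0 : 0 < theta by rewrite !divr_gt0.
have th1 : theta <= 1.
  rewrite ler_pdivrMr // mul1r; apply: (@le_trans _ _ ((2 * t) ^+ n)); first lra.
  by move: t0; clear => t0; apply: lerXn2r; rewrite ?nnegrE; lra.
have thE : theta * (16 * t) ^+ n = lo / 2 by rewrite divfK // gt_eqF.
have key : M - m <= C3 * (1 + ln theta^-1).
  apply: (H3 n f x y0 t M m theta om n0 Ff.1 t0 hM xy0 fy0 omB hm); first by rewrite th0.
  by rewrite loE thE lte_fin; lra.
pose q := (expR 1 + 2 * 16 ^+ n / bn) * lB / lo.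
have e1 : 0 < expR 1 :> R by exact: expR_gt0.
have c16 : 0 < 2 * 16 ^+ n / bn by rewrite divr_gt0 // mulr_gt0 // exprn_gt0.
have q1 : expR 1 <= q.
  by rewrite /q ler_pdivlMr //; apply: ler_pM; rewrite ?lerDl //; exact: ltW.
(* Here [theta^-1 = 2 * (16 * t) ^+ n / lo], and [t ^+ n * bn <= lB] turns it into the second
   summand of [d]. *)
have q2 : theta^-1 <= q.
  rewrite /q ler_pdivlMr // /theta !invfM !invrK.
  have -> : lo^-1 * 2 * (16 * t) ^+ n * lo = 2 * 16 ^+ n / bn * (t ^+ n * bn).
    by rewrite exprMn; field; rewrite !gt_eqF.
  by apply: ler_pM => //; [exact: ltW|rewrite mulr_ge0 // ltW|rewrite lerDr ltW].
have q0 : 0 < q by apply: lt_le_trans q1.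
have lq1 : 1 <= ln q by rewrite -[1](expRK 1) ler_ln ?posrE.
have lq2 : ln theta^-1 <= ln q by rewrite ler_ln ?posrE // invr_gt0.
have fin : M <= 2 * C3 * ln q + m.
  have := ler_wpM2l (ltW C30) lq1; have := ler_wpM2l (ltW C30) lq2.
  by move: key; clear; lra.
apply: (@le_trans _ _ M%:E).
  by apply: ge_ereal_sup => _ [y hy <-]; rewrite lee_fin; exact: fB.
by rewrite -mE -EFinD lee_fin.
Qed.

Theorem theorem1p2 (R : realType) :
  exists (c : R -> R -> R) (d : nat -> R),
    (forall a r : R, 1 < a -> 1 < r -> 0 < c a r) /\ (forall n, 0 < d n) /\
    forall (n : nat) (r a : R), (1 <= n)%N -> 1 < r -> 1 < a ->
    forall (f : Cn R n -> R), classF r f ->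
    forall (x : Rn R n) (t : R), 0 < t ->
      realpt @` ballR x t `<=` ballC (realpt x) (a * t) ->
      ballC (realpt x) (a * t) `<=` ballC (realpt (fun _ => 0%R)) 1 ->
    forall (om : set (Rn R n)), om `<=` ballR x t -> leb_measurable om ->
      (0 < leb_outer om)%E ->
      (ereal_sup [set (f (realpt y))%:E | y in ballR x t] <=
       (c a r * ln (d n * fine (leb_outer (ballR x t)) / fine (leb_outer om)))%:E
       + ereal_sup [set (f (realpt y))%:E | y in om])%E.
Proof.
pose Q (p : R * R) (c : R) := 0 < c /\ forall n (f : Cn R n -> R) (x : Rn R n) (t : R)
      (om : set (Rn R n)), (0 < n)%N -> classF p.2 f -> 0 < t ->
    realpt @` ballR x t `<=` ballC (realpt x) (p.1 * t) ->
    ballC (realpt x) (p.1 * t) `<=` ballC (realpt (fun=> 0)) 1 ->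
    om `<=` ballR x t -> (0 < leb_outer om)%E ->
    (ereal_sup [set (f (realpt y))%:E | y in ballR x t] <=
     (c * ln ((expR 1 + 2 * 16 ^+ n / unit_ball_vol R n) *
        fine (leb_outer (ballR x t)) / fine (leb_outer om)))%:E
     + ereal_sup [set (f (realpt y))%:E | y in om])%E.
(* One function [c] for all pairs, with the default value 0 outside [a > 1], [r > 1]. *)
have /choice[c hc] : forall p : R * R, exists c, 1 < p.1 -> 1 < p.2 -> Q p c.
  move=> [a r]; have [a1|a1] := boolP (1 < a); last by exists 0 => h; case/negP: a1.
  have [r1|r1] := boolP (1 < r); last by exists 0 => _ h; case/negP: r1.
  by have [c c0 hc] := local_inequality a1 r1; exists c.
exists (fun a r => c (a, r)), (fun n => expR 1 + 2 * 16 ^+ n / unit_ball_vol R n).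
split; first by move=> a r a1 r1; have [] := hc (a, r) a1 r1.
split.
  move=> n; rewrite ltr_pwDl ?expR_gt0 // divr_ge0 ?mulr_ge0 ?exprn_ge0 //.
  exact/fine_ge0/leb_outer_ge0.
move=> n r a n1 r1 a1 f Ff x t t0 BB hsub om omB _ om0.
by have [_ h] := hc (a, r) a1 r1; apply: h.
Qed.
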